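(* Let $G$ be a finite-dimensional real vector space partially ordered by a closed and pointed convex cone $C\subset G$. Then the combinatorially positive $\mathbb{R}^d$-valuations $\varphi:\mathcal{P}(\mathbb{R}^d)\to G$ are exactly the maps $c\,\mathrm{vol}_d$ with $c\in C$, and $c\mapsto c\,\mathrm{vol}_d$ is an isomorphism from $C$ onto the cone of combinatorially positive $\mathbb{R}^d$-valuations into $G$.
   Context: $\mathcal{P}(\mathbb{R}^d)$ is the set of all convex polytopes in $\mathbb{R}^d$ (including $\emptyset$); $\mathrm{vol}_d$ is $d$-dimensional volume. The partial order is $x\preceq y$ iff $y-x\in C$. An $\mathbb{R}^d$-valuation is a map $\varphi:\mathcal{P}(\mathbb{R}^d)\to G$ with $\varphi(\emptyset)=0$, $\varphi(P\cup Q)+\varphi(P\cap Q)=\varphi(P)+\varphi(Q)$ whenever $P,Q,P\cup Q\in\mathcal{P}(\mathbb{R}^d)$, and $\varphi(t+P)=\varphi(P)$ for all $t\in\mathbb{R}^d$. For an $r$-dimensional polytope $P$ there are unique $h_0,\dots,h_r\in G$ with $\varphi(nP)=\sum_{i=0}^r h_i\binom{n+r-i}{r}$ for all integers $n\ge0$; set $h^\varphi_i(P)=h_i$ for $i\le r$ and $h^\varphi_i(P)=0$ for $r<i\le d$ (and $h^\varphi(\emptyset)=0$). $\varphi$ is combinatorially positive if $h^\varphi_i(P)\succeq0$ for all polytopes $P$ and all $0\le i\le d$. *)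

(* Defs.v *)
From HB Require Import structures.
From mathcomp Require Import all_boot all_order all_algebra.
From mathcomp Require Import all_classical all_reals all_analysis.

Set Implicit Arguments.
Unset Strict Implicit.
Unset Printing Implicit Defensive.

Import Order.TTheory GRing.Theory Num.Theory.
Import numFieldNormedType.Exports.

Local Open Scope classical_set_scope.
Local Open Scope ring_scope.

Section Polytopes.
Context {R : realType} {d : nat}.
Implicit Types (A : set 'rV[R]_d) (t : 'rV[R]_d).

Definition conv_hull n (v : 'I_n -> 'rV[R]_d) : set 'rV[R]_d :=
  [set \sum_i w i *: v i | w in
    [set w : 'I_n -> R | (forall i, 0 <= w i) /\ \sum_i w i = 1]].

(* [n = 0] is allowed and gives the empty polytope. *)
Definition is_polytope A := exists n (v : 'I_n -> 'rV[R]_d), A = conv_hull v.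

Record polytope := Polytope {
  pset :> set 'rV[R]_d;
  psetP : is_polytope pset
}.

Lemma pset_inj : injective pset.
Proof.
case=> A hA [B hB] /= AB; move: hB; rewrite -AB => hB.
by congr Polytope; exact: Prop_irrelevance.
Qed.

Lemma is_polytope_translate t (P : polytope) :
  is_polytope [set t + x | x in pset P].
Proof.
case: (psetP P) => n [v ->]; exists n, (fun i => t + v i).
have E (w : 'I_n -> R) : \sum_i w i = 1 ->
    t + \sum_i w i *: v i = \sum_i w i *: (t + v i).
  move=> w1; under [RHS]eq_bigr do rewrite scalerDr.
  by rewrite big_split /= -scaler_suml w1 scale1r.
apply/seteqP; split=> x /=.
  by move=> [_ [w [w0 w1] <-] <-]; exists w => //; rewrite E.
move=> [w [w0 w1] <-]; exists (\sum_i w i *: v i); first by exists w.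
exact: E.
Qed.

Definition translate t (P : polytope) : polytope :=
  Polytope (is_polytope_translate t P).

Lemma is_polytope_dilate (n : nat) (P : polytope) :
  is_polytope [set n%:R *: x | x in pset P].
Proof.
case: (psetP P) => m [v ->]; exists m, (fun i => n%:R *: v i).
have E (w : 'I_m -> R) :
    n%:R *: (\sum_i w i *: v i) = \sum_i w i *: (n%:R *: v i).
  rewrite scaler_sumr; apply: eq_bigr => i _.
  by rewrite !scalerA mulrC.
apply/seteqP; split=> x /=.
  by move=> [_ [w hw <-] <-]; exists w => //; rewrite E.
by move=> [w hw <-]; exists (\sum_i w i *: v i); [exists w | exact: E].
Qed.

(* For [n = 0] this is [{0}] when [P] is nonempty. *)
Definition dilate (n : nat) (P : polytope) : polytope :=
  Polytope (is_polytope_dilate n P).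

(* Dimension of the affine hull, i.e. the least dimension of an affine
   subspace [x + U] containing [A]; only meaningful for nonempty [A]. *)
Definition affine_dim A : nat :=
  [arg min_(r < (ord_max : 'I_d.+1) |
     `[< exists (x : 'rV[R]_d) (U : {vspace 'rV[R]_d}),
           \dim U = r /\ forall y, A y -> y - x \in U >]) (r : nat)].

End Polytopes.

Arguments polytope R d : clear implicits.

(* [d]-dimensional Lebesgue measure, as the iterated product (in the sense of
   [product_measure1]) of the one-dimensional one; for [d = 0], the point mass. *)
Fixpoint lebesgue_vol {R : realType} {d : nat} : set 'rV[R]_d -> \bar R :=
  match d return set 'rV[R]_d -> \bar R with
  | 0 => fun A => (\1_A (0 : 'rV[R]_0))%:E
  | d'.+1 => fun A => (\int[lebesgue_measure]_(x in setT)
      lebesgue_vol [set y : 'rV[R]_d' | A (row_mx (x : R)%:M y : 'rV[R]_(1 + d'))])%E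
  end.

Definition vol {R : realType} {d : nat} (P : polytope R d) : R :=
  fine (lebesgue_vol P).

Section Cones.
Context {R : realType}.

Definition convex_cone {V : lmodType R} (C : set V) :=
  [/\ C 0, (forall x y, C x -> C y -> C (x + y)) &
      (forall (a : R) x, 0 <= a -> C x -> C (a *: x))].

Definition pointed_cone {V : lmodType R} (C : set V) :=
  forall x, C x -> C (- x) -> x = 0.

(* Closedness for the vector space topology of a finite-dimensional space,
   read in the coordinates of a basis. *)
Definition vect_closed {V : vectType R} (C : set V) :=
  closed [set \row_i coord (vbasis {:V}) i x | x in C].

Definition cone_le {V : lmodType R} (C : set V) (x y : V) := C (y - x).

Definition cone_isomorphism {V W : lmodType R} (C : set V) (D : set W)
    (f : V -> W) :=
  [/\ set_bij C D f,
      (forall x y, C x -> C y -> f (x + y) = f x + f y) &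
      (forall (a : R) x, 0 <= a -> C x -> f (a *: x) = a *: f x)].

End Cones.

Section Valuations.
Context {R : realType} {d : nat} {G : vectType R}.
Implicit Types (P Q : polytope R d) (phi : polytope R d -> G) (C : set G).

(* [I] always exists, intersections of polytopes being polytopes. *)
Definition is_valuation phi :=
  [/\ (forall P, pset P = set0 -> phi P = 0),
      (forall P Q U I : polytope R d, pset U = pset P `|` pset Q ->
         pset I = pset P `&` pset Q -> phi U + phi I = phi P + phi Q) &
      (forall t P, phi (translate t P) = phi P)].

Definition is_hvector phi P (h : 'I_d.+1 -> G) :=
  let r := affine_dim P in
  (pset P = set0 -> forall i, h i = 0) /\
  (pset P !=set0 ->
     (forall n : nat, phi (dilate n P) =
        \sum_(i < d.+1 | (i <= r)%N) h i *+ 'C(n + r - i, r)) /\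
     (forall i : 'I_d.+1, (r < i)%N -> h i = 0)).

Lemma is_hvector_unique phi P h1 h2 :
  is_hvector phi P h1 -> is_hvector phi P h2 -> h1 = h2.
Proof.
move=> [e1 n1] [e2 n2]; apply/funext => i.
have [P0|] := pselect (pset P = set0); first by rewrite e1 ?e2.
move/eqP/set0P => Pn; have {n1} [p1 z1] := n1 Pn; have {n2} [p2 z2] := n2 Pn.
set r := affine_dim P in p1 p2 z1 z2.
have [m] := ubnP (i : nat); elim: m i => // m IH i im.
have [ri|ir] := ltnP r i; first by rewrite z1 ?z2.
have := p1 i; rewrite p2 (bigD1 i) //= [RHS](bigD1 i) //= addnC addnK binn !mulr1n.
suff -> : \sum_(j < d.+1 | (j <= r)%N && (j != i)) h2 j *+ 'C(r + i - j, r) =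
          \sum_(j < d.+1 | (j <= r)%N && (j != i)) h1 j *+ 'C(r + i - j, r).
  by move/addIr.
apply: eq_bigr => j /andP[jr ji].
case: (ltngtP j i) => [ji'|ij|/val_inj eij]; last by rewrite eij eqxx in ji.
  by rewrite IH // (leq_trans ji').
rewrite bin_small ?mulr0n // ltn_subLR; first by rewrite addnC ltn_add2r.
exact: leq_trans jr (leq_addr _ _).
Qed.

(* For a valuation the vector [h] always exists (McMullen's theorem on the
   polynomiality of [n |-> phi (n P)]), and it is unique by
   [is_hvector_unique]. *)
Definition combinatorially_positive C phi :=
  forall P, exists2 h : 'I_d.+1 -> G,
    is_hvector phi P h & forall i, cone_le C 0 (h i).

Definition cp_valuations C : set (polytope R d -> G) :=
  [set phi | is_valuation phi /\ combinatorially_positive C phi].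

Definition scaled_vol (c : G) : polytope R d -> G := fun P => vol P *: c.

End Valuations.

(* Main.v *)
(** Let [phi] be combinatorially positive.  If [P] has dimension [r < d], take [u]
    transverse to [P] and let [P_k] be the prism [P + [0, u / k]], of dimension
    [r + 1].  Cutting prisms gives
    [phi (n P_k) = (1 - 1/k) phi (n P) + (1/k) phi (n P_1)], so [h(P_k)] tends to
    the [h]-vector of [P] rewritten in degree [r + 1], which is
    [h_i(P) - h_{i-1}(P)].  By closedness these differences lie in [C]; as
    [h_{r+1}(P) = 0] and all [h_i(P)] lie in [C], pointedness gives [h(P) = 0].
    So [phi] is nonnegative and vanishes on polytopes of dimension less than [d].
    Hence it is monotone (cut along the facets of the smaller polytope), and it
    agrees with [phi([0,1]^d) vol] on small cubes; comparing on the cells of a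
    fine grid, which lie in [(1 + eps) P] as soon as they meet [P], bounds
    [phi P] on both sides by [phi([0,1]^d) vol ((1 +- eps) P)].
    Conversely, Worpitzky's identity writes [n ^ d vol P] with nonnegative
    coefficients in the basis [C(n + d - i, d)]. *)
From Pilot Require Import Defs.
From HB Require Import structures.
From mathcomp Require Import all_boot all_order all_algebra.
From mathcomp Require Import all_classical all_reals all_analysis.
From mathcomp Require Import measurable_realfun zify ring lra.

Set Implicit Arguments.
Unset Strict Implicit.
Unset Printing Implicit Defensive.

Import Order.TTheory GRing.Theory Num.Theory.
Import numFieldNormedType.Exports.
(* [probability] also defines a constant [pset]. *)
Import Pilot.Defs.

Local Open Scope classical_set_scope.
Local Open Scope ring_scope.

(** * Lebesgue volume as a measure *)

(** Two features of the definitions shape the proof. [lebesgue_vol] is an iterated integral defined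
    on all sets of row vectors, without a sigma-algebra on them; additivity and monotonicity are
    therefore read off a measure on an iterated product space. Polytopes are given as convex hulls,
    whereas a valuation is exploited by cutting with hyperplanes; so hulls must be shown stable
    under cuts and equal to finite intersections of half-spaces.

    The thin prisms exploit that positivity depends on the dimension in which the polynomial of P is
    expanded. Limits in [G] are never taken explicitly: each one is expressed by y + k x in C for
    all k, which forces x in C. Errors must then be linear in 1 / k, and this is the origin of the
    constant 3 ^ d. The two bounds on [phi] are one statement about a pair of nonnegative valuations
    that vanish on flat polytopes and agree on the unit cube, used twice with the roles
    exchanged. *)

Section OneDim.
Context {R : realType}.
Local Notation mu := (@lebesgue_measure R).

Lemma affine_preimage_itvoc (a b l r : R) : 0 < a ->
  (fun x : R => a * x + b) @^-1` `]l, r] = `](l - b) / a, (r - b) / a]%classic.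
Proof.
move=> a0; apply/seteqP; split => x /=; rewrite !in_itv /=;
  by rewrite ltr_pdivrMr// ler_pdivlMr// (mulrC x) ltrBlDr lerBrDr.
Qed.

Lemma measurable_affine (a b : R) :
  measurable_fun [set: measurableTypeR R]
    (fun x : measurableTypeR R => a * x + b : measurableTypeR R).
Proof. by apply: measurable_funD => //; exact: measurable_funM. Qed.

(** Multiplied by a, the pushforward agrees with [mu] on half-open intervals, and this determines
    Lebesgue measure. *)
Lemma lebesgue_measure_affine (a b : R) (A : set R) : 0 < a -> measurable A ->
  pushforward mu (fun x : measurableTypeR R => a * x + b : measurableTypeR R) A
  = (a^-1%:E * mu A)%E.
Proof.
move=> a0 mA.
have a0' : 0 <= a by exact: ltW.
have maff := measurable_affine a b.
pose nu : {measure set (measurableTypeR R) -> \bar R} := mscale (NngNum a0')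
  (pushforward mu (fun x : measurableTypeR R => a * x + b : measurableTypeR R)).
suff H : forall X, ocitv X -> mu X = nu maff X.
  rewrite (lebesgue_measure_unique H) // /nu.
  by rewrite /mscale /= muleA -EFinM mulVf ?gt_eqF// mul1e.
move=> _ [[l r]] _ <-.
change (mu `]l, r] = (a%:E * mu ((fun x : R => (a * x + b)%R) @^-1` `]l, r]))%E).
rewrite affine_preimage_itvoc// !lebesgue_measure_itv /=.
rewrite !lte_fin ltr_pM2r ?invr_gt0// ltrD2r; case: ifP => _; last by rewrite mule0.
by rewrite -!EFinD -EFinM; congr EFin; field; rewrite gt_eqF.
Qed.

Lemma integral_affine (a b : R) (f : R -> \bar R) : 0 < a ->
  measurable_fun [set: measurableTypeR R] f -> (forall x, 0 <= f x)%E ->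
  (\int[mu]_x f (a * x + b)%R = a^-1%:E * \int[mu]_x f x)%E.
Proof.
move=> a0 mf f0.
have ai0 : 0 <= a^-1 by rewrite invr_ge0 ltW.
rewrite -[LHS](ge0_integral_pushforward (measurable_affine a b) mu (D := setT))//.
rewrite (eq_measure_integral (mscale (NngNum ai0) mu)).
  by rewrite ge0_integral_mscale.
  exact: measurable_affine.
by move=> maff A mA _; exact: (lebesgue_measure_affine b a0 mA).
Qed.
End OneDim.

(** The same term as in the body of [lebesgue_vol], so that sections written with it are convertible
    to the unfolded integrand. *)
Definition cons_rv {R : realType} d (x : R) (y : 'rV[R]_d) : 'rV[R]_d.+1 :=
  row_mx x%:M y : 'rV_(1 + d).

Lemma cons_rv0 (R : realType) d (x : R) (y : 'rV[R]_d) : cons_rv x y 0 ord0 = x.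
Proof.
rewrite /cons_rv (_ : ord0 = lshift d (0 : 'I_1)); last exact: val_inj.
by rewrite (@row_mxEl _ 1 1 d) mxE eqxx mulr1n.
Qed.

Lemma cons_rvS (R : realType) d (x : R) (y : 'rV[R]_d) i :
  cons_rv x y 0 (lift ord0 i) = y 0 i.
Proof.
rewrite /cons_rv (_ : lift ord0 i = rshift 1 i); last exact: val_inj.
by rewrite (@row_mxEr _ 1 1 d).
Qed.

(** Keeps the induction of [lebesgue_vol_measure] going, where the product becomes a factor of the
    next one. The exhaustions are nondecreasing so that one index serves both coordinates. *)
Lemma product_measure_sigma_finite d1 d2 (T1 : measurableType d1)
    (T2 : measurableType d2) (R : realType)
    (m1 : {sigma_finite_measure set T1 -> \bar R})
    (m2 : {sigma_finite_measure set T2 -> \bar R}) :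
  sigma_finite [set: T1 * T2] (m1 \x m2)%E.
Proof.
have /sigma_finiteP[F [TF ndF Foo]] := sigma_finiteT m1.
have /sigma_finiteP[G [TG ndG Goo]] := sigma_finiteT m2.
exists (fun n => F n `*` G n) => [|n].
  apply/esym/seteqP; split => // -[x y] _.
  have : [set: T1] x by []. have : [set: T2] y by [].
  rewrite {1}TF {1}TG => -[k _ Gy] [n _ Fx]; exists (maxn n k) => //; split.
    by move: Fx; apply/subsetPset/ndF/leq_maxl.
  by move: Gy; apply/subsetPset/ndG/leq_maxr.
have [mF Fn] := Foo n; have [mG Gn] := Goo n; split; first exact: measurableX.
by rewrite product_measure1E// lte_mul_pinfty// ge0_fin_numE.
Qed.

(** T is the iterated product of copies of the line, ending in [unit] with a point mass, and f
    assembles the coordinates. The product measure unfolds to the integral of the measures of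
    sections, which is the recursion of [lebesgue_vol]. *)
Lemma lebesgue_vol_measure (R : realType) (d : nat) :
  exists disp (T : measurableType disp)
         (mu : {sigma_finite_measure set T -> \bar R}) (f : T -> 'rV[R]_d),
    (forall i, measurable_fun [set: T] (fun t => f t 0 i)) /\
    (forall A : set 'rV[R]_d, lebesgue_vol A = mu (f @^-1` A)).
Proof.
elim: d => [|d [disp [T [mu [f [mf vf]]]]]].
  exists _, unit, \d_tt, (fun _ => 0); split => [[]//|A].
  by rewrite /= diracE indicE; congr (_%:R)%:E; apply/f_equal/idP/idP; rewrite !inE.
exists _, (measurableTypeR R * T)%type.
pose sf := Measure_isSigmaFinite.Build _ _ _ (@lebesgue_measure R \x mu)%E
  (product_measure_sigma_finite _ _).
pose nu : {sigma_finite_measure set (measurableTypeR R * T)%type -> \bar R} :=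
  HB.pack (@lebesgue_measure R \x mu)%E sf.
exists nu.
exists (fun p => cons_rv (p.1 : R) (f p.2)); split.
  move=> i; case: (unliftP ord0 i) => [j|] ->.
    under eq_fun do rewrite cons_rvS.
    exact: measurableT_comp (mf j) _.
  under eq_fun do rewrite cons_rv0.
  exact: measurable_fst.
move=> A /=; rewrite /nu /= /product_measure1; apply: eq_integral => x _ /=.
rewrite vf; congr (mu _); apply/seteqP; split => t /=; by rewrite /xsection /= inE.
Qed.

(** * Measurable sets of row vectors and the laws of volume *)

Section CoordMeasurable.
Context {R : realType}.

(* Borel sets of ['rV_d], without equipping ['rV_d] with a sigma-algebra. *)
Definition coord_measurable d (A : set 'rV[R]_d) :=
  forall disp (T : measurableType disp) (f : T -> 'rV[R]_d),
    (forall i, measurable_fun [set: T] (fun t => f t 0 i)) ->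
    measurable (f @^-1` A).

Lemma coord_measurableI d (A B : set 'rV[R]_d) :
  coord_measurable A -> coord_measurable B -> coord_measurable (A `&` B).
Proof.
by move=> mA mB disp T f mf; rewrite preimage_setI; apply: measurableI; [exact: mA|exact: mB].
Qed.

Lemma coord_measurableT d : coord_measurable [set: 'rV[R]_d].
Proof. by move=> disp T f mf; rewrite preimage_setT. Qed.

Lemma coord_measurable_halfspace d (l : 'cV[R]_d) (b : R) :
  coord_measurable [set x : 'rV_d | 0 <= (x *m l) 0 0 + b].
Proof.
move=> disp T f mf.
pose g t := \sum_j f t 0 j * l j 0 + b.
have mg : measurable_fun [set: T] g.
  apply: measurable_funD => //; apply: measurable_sum => j.
  by apply: measurable_funM => //; exact: mf.
have := mg measurableT `[0, +oo[%classic (measurable_itv _); rewrite setTI.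
by congr (measurable _); apply/seteqP; split => t; rewrite /= in_itv /= andbT /g mxE.
Qed.

Lemma coord_measurable_section d (A : set 'rV[R]_d.+1) (x : R) :
  coord_measurable A ->
  coord_measurable [set y : 'rV_d | A (cons_rv x y)].
Proof.
move=> mA disp T f mf; apply: (mA _ T (fun t => cons_rv x (f t))) => i.
case: (unliftP ord0 i) => [j|] ->.
  by under eq_fun do rewrite cons_rvS; exact: mf.
by under eq_fun do rewrite cons_rv0; exact: measurable_cst.
Qed.

Lemma lebesgue_vol_section_measurable d (A : set 'rV[R]_d.+1) : coord_measurable A ->
  measurable_fun [set: measurableTypeR R]
    (fun x : R => lebesgue_vol [set y : 'rV_d | A (cons_rv x y)]).
Proof.
move=> mA; have [disp [T [mu [f [mf vf]]]]] := lebesgue_vol_measure R d.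
pose F (p : measurableTypeR R * T) := cons_rv (p.1 : R) (f p.2).
have mF : measurable (F @^-1` A).
  apply: mA => i; case: (unliftP ord0 i) => [j|] ->.
    under eq_fun do rewrite cons_rvS.
    exact: measurableT_comp (mf j) _.
  under eq_fun do rewrite cons_rv0.
  exact: measurable_fst.
apply: eq_measurable_fun (measurable_fun_xsection mu mF) => x _ /=.
by rewrite vf; congr (mu _); apply/seteqP; split => t /=; rewrite /xsection /= inE.
Qed.

Lemma lebesgue_vol_ge0 d (A : set 'rV[R]_d) : (0 <= lebesgue_vol A)%E.
Proof. by have [? [T [mu [f [_ ->]]]]] := lebesgue_vol_measure R d. Qed.

Lemma lebesgue_vol0 d : lebesgue_vol (set0 : set 'rV[R]_d) = 0%E.
Proof.
have [? [T [mu [f [_ ->]]]]] := lebesgue_vol_measure R d.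
by rewrite preimage_set0 measure0.
Qed.

Lemma lebesgue_vol_le d (A B : set 'rV[R]_d) : coord_measurable A ->
  coord_measurable B -> A `<=` B -> (lebesgue_vol A <= lebesgue_vol B)%E.
Proof.
move=> mA mB AB; have [? [T [mu [f [mf vf]]]]] := lebesgue_vol_measure R d.
rewrite !vf; apply: le_measure; rewrite ?inE; [exact: mA|exact: mB|].
exact: preimage_subset.
Qed.

Lemma lebesgue_volUI d (A B : set 'rV[R]_d) :
  coord_measurable A -> coord_measurable B ->
  (lebesgue_vol (A `|` B) + lebesgue_vol (A `&` B) = lebesgue_vol A + lebesgue_vol B)%E.
Proof.
move=> mA mB; have [? [T [mu [f [mf vf]]]]] := lebesgue_vol_measure R d.
have mfA := mA _ _ _ mf; have mfB := mB _ _ _ mf.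
rewrite !vf preimage_setU preimage_setI.
set X := f @^-1` A in mfA *; set Y := f @^-1` B in mfB *.
have mD : measurable (Y `\` X) by exact: measurableD.
have EU : X `|` Y = X `|` (Y `\` X) by apply/seteqP; split => t /=; have [Xt|Xt] := pselect (X t); tauto.
have EY : Y = (Y `\` X) `|` (X `&` Y) by apply/seteqP; split => t /=; have [Xt|Xt] := pselect (X t); tauto.
rewrite EU measureU//; last by rewrite setDE setICA setICr setI0.
rewrite [in RHS]EY measureU//; last 2 first.
- exact: measurableI.
- by apply/seteqP; split => t // [[_ +] []].
by rewrite addeA.
Qed.

(** Each coordinate contributes one factor: the head of b shifts the integration variable, and its
    tail goes into the induction hypothesis on sections. *)
Lemma lebesgue_vol_affine d (A : set 'rV[R]_d) (a : R) (b : 'rV_d) :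
  0 < a -> coord_measurable A ->
  lebesgue_vol [set y | A (a *: y + b)] = ((a^-1 ^+ d)%:E * lebesgue_vol A)%E.
Proof.
move=> a0; elim: d A b => [|d IH] A b mA.
  rewrite expr0 mul1e /= !indicE.
  rewrite (_ : [set y | A (a *: y + b)] = A) //.
  by apply/seteqP; split => y /=; rewrite (thinmx0 (a *: y + b)) (thinmx0 y).
pose g x := lebesgue_vol [set y : 'rV_d | A (cons_rv x y)].
pose b0 := b 0 ord0; pose b1 := \row_j b 0 (lift ord0 j).
transitivity (\int[lebesgue_measure]_(x in [set: R])
    ((a^-1 ^+ d)%:E * g (a * x + b0)%R))%E.
  apply: eq_integral => x _; rewrite -(IH _ b1); last exact: coord_measurable_section.
  have E (y : 'rV_d) : a *: cons_rv x y + b = cons_rv (a * x + b0) (a *: y + b1).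
    apply/rowP => i.
    have M (u v : 'rV[R]_d.+1) k : (a *: u + v) 0 k = a * u 0 k + v 0 k by rewrite !mxE.
    case: (unliftP ord0 i) => [j|] ->; rewrite M ?cons_rv0 ?cons_rvS //.
    by rewrite !mxE.
  by rewrite /g; congr lebesgue_vol; apply/seteqP; split => y; rewrite /= -E.
have mg := lebesgue_vol_section_measurable mA.
have ai : 0 <= a^-1 by rewrite invr_ge0 ltW.
rewrite ge0_integralZl_EFin //=; last 3 first.
- by move=> x _; exact: lebesgue_vol_ge0.
- apply: measurableT_comp => //; exact: measurable_affine.
- exact: exprn_ge0.
rewrite (@integral_affine _ a b0 g) //; last by move=> x; exact: lebesgue_vol_ge0.
by rewrite muleA -EFinM -exprSr.
Qed.

Lemma row_mulE d (u : 'rV[R]_d) (v : 'cV[R]_d) :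
  (u *m v) 0 0 = \sum_j u 0 j * v j 0.
Proof. by rewrite mxE. Qed.

(** If the tail of l is nonzero, every section is a hyperplane one dimension lower. Otherwise the
    head a is nonzero and only the section over - b / a can be nonempty, so the integral lives on
    one point. *)
Lemma lebesgue_vol_hyperplane d (l : 'cV[R]_d) (b : R) : l != 0 ->
  lebesgue_vol [set x : 'rV_d | (x *m l) 0 0 + b = 0] = 0%E.
Proof.
elim: d l b => [|d IH] l b l0; first by rewrite (flatmx0 l) eqxx in l0.
pose a := l ord0 0; pose l1 := \col_j l (lift ord0 j) 0.
have E x (y : 'rV_d) : (cons_rv x y *m l) 0 0 + b = (y *m l1) 0 0 + (x * a + b).
  rewrite !row_mulE big_ord_recl cons_rv0 -addrA [RHS]addrCA; congr (_ + (_ + _)).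
  by apply: eq_bigr => i _; rewrite cons_rvS mxE.
have [l10|l10] := eqVneq l1 0; last first.
  apply: integral0_eq => x _ /=; rewrite -[RHS](IH l1 (x * a + b) l10).
  by congr lebesgue_vol; apply/seteqP; split => y /=; rewrite E.
have a0 : a != 0.
  apply: contra_neq l0 => a0; apply/colP => i; rewrite mxE.
  case: (unliftP ord0 i) => [j|] ->; last exact: a0.
  by move/colP: l10 => /(_ j); rewrite !mxE.
pose g x := lebesgue_vol [set y : 'rV_d | (cons_rv x y *m l) 0 0 + b = 0].
rewrite -[LHS]/(\int[lebesgue_measure]_(x in [set: R]) g x)%E.
have -> : g = g \_ [set - b / a].
  apply/funext => x; rewrite patchE; case: ifPn => //; rewrite notin_setE /= => xb.
  rewrite /g -[RHS](lebesgue_vol0 d); congr lebesgue_vol.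
  apply/seteqP; split => y //=; rewrite E l10 mulmx0 mxE add0r => H.
  by apply: xb; apply/eqP; rewrite eq_sym; apply/eqP; move/eqP: H; rewrite addr_eq0 => /eqP <-; rewrite mulfK.
by rewrite -integral_mkcond integral_set1.
Qed.

Lemma lebesgue_vol_cube d :
  lebesgue_vol [set x : 'rV[R]_d | forall i, 0 <= x 0 i <= 1] = 1%E.
Proof.
elim: d => [|d IH]; first by rewrite /= indicE mem_set //= => -[].
transitivity (\int[lebesgue_measure]_(x in [set: R]) (\1_(`[0, 1]%classic) x)%:E)%E.
  apply: eq_integral => x _; rewrite indicE.
  have [x01|x01] := pselect (0 <= x <= 1).
    rewrite mem_set; last by rewrite /= in_itv.
    rewrite -[RHS]IH; congr lebesgue_vol; apply/seteqP; split => y /= H i.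
      by rewrite -(cons_rvS x).
    by case: (unliftP ord0 i) => [j|] ->; rewrite -/(cons_rv x y) ?cons_rv0 ?cons_rvS.
  rewrite memNset; last by rewrite /= in_itv.
  rewrite -[RHS](lebesgue_vol0 d); congr lebesgue_vol; apply/seteqP; split => y //= H.
  by apply: x01; have := H ord0; rewrite -/(cons_rv x y) cons_rv0.
rewrite integral_indic // setIT -[LHS]/(lebesgue_measure `[0, 1]%classic).
rewrite lebesgue_measure_itv /= lte_fin ltr01.
by rewrite -EFinB subr0.
Qed.

End CoordMeasurable.

(** * Polytopes and half-spaces *)

Section PolytopeGeometry.
Context {R : realType}.

Lemma mx11_subZ (u v : 'M[R]_1) a : (u - a *: v) 0 0 = u 0 0 - a * v 0 0.
Proof. by rewrite !mxE. Qed.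

Lemma mx11_Z (u : 'M[R]_1) a : (a *: u) 0 0 = a * u 0 0.
Proof. by rewrite !mxE. Qed.

(** The linear part [h.1] may be zero, so a half-space may also be the whole space or empty;
    arguments about genuine hyperplanes ask for [h.1 != 0]. *)
Definition aff d (h : 'cV[R]_d * R) (x : 'rV[R]_d) : R := (x *m h.1) 0 0 + h.2.

Definition halfspace d (h : 'cV[R]_d * R) : set 'rV[R]_d := [set x | 0 <= aff h x].

Definition aff_opp d (h : 'cV[R]_d * R) := (- h.1, - h.2).

Lemma aff_oppE d (h : 'cV[R]_d * R) x : aff (aff_opp h) x = - aff h x.
Proof. by rewrite /aff /= mulmxN mxE opprD. Qed.

Lemma aff_sum d (h : 'cV[R]_d * R) (I : finType) (P : pred I) (w : I -> R) v :
  \sum_(i | P i) w i = 1 ->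
  aff h (\sum_(i | P i) w i *: v i) = \sum_(i | P i) w i * aff h (v i).
Proof.
move=> w1; rewrite /aff mulmx_suml summxE -[X in _ + X]mul1r -w1 mulr_suml -big_split.
by apply: eq_bigr => i _; rewrite -scalemxAl mxE mulrDr.
Qed.

Lemma aff_comb d (h : 'cV[R]_d * R) a b x y : a + b = 1 ->
  aff h (a *: x + b *: y) = a * aff h x + b * aff h y.
Proof.
have M (u v : 'M[R]_1) : (a *: u + b *: v) 0 0 = a * u 0 0 + b * v 0 0 by rewrite !mxE.
move=> ab; rewrite /aff mulmxDl -!scalemxAl M !mulrDr addrACA; congr (_ + _).
by rewrite -mulrDl ab mul1r.
Qed.

(** Lets the generators of cuts and prisms be indexed by sums and products of types instead of being
    renumbered. *)
Lemma is_polytope_conv d (I : finType) (P : pred I) (v : I -> 'rV[R]_d) :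
  is_polytope [set \sum_(i | P i) w i *: v i | w in
    [set w : I -> R | (forall i, P i -> 0 <= w i) /\ \sum_(i | P i) w i = 1]].
Proof.
have big_val (V : nmodType) (f : I -> V) :
  \sum_(i | P i) f i = \sum_(k < #|P|) f (enum_val k) by rewrite -(big_enum_val (A := [pred i | P i])) .
exists #|P|, (v \o enum_val); apply/seteqP; split => x /=.
  move=> [w [w0 w1] <-]; exists (w \o enum_val); last by rewrite big_val.
  split => [i|]; last by rewrite -w1 big_val.
  by apply: w0; exact: (enum_valP i).
(* Ranking the elements of P needs one of them as a default; if there is none, the weights sum to 0
   and not to 1. *)
move=> [w [w0 w1] <-]; have [i0 Pi0|P0] := pickP P; last first.
  have E : #|P| = 0%N by apply: eq_card0 => i; exact: P0.
  move/eqP: w1; rewrite big1 ?(eq_sym 0) ?oner_eq0 // => i _.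
  by have := ltn_ord i; rewrite [X in (_ < X)%N]E.
have i0P : i0 \in P by [].
exists (w \o enum_rank_in i0P); last first.
  by rewrite big_val; apply: eq_bigr => k _ /=; rewrite enum_valK_in.
split => [i _|]; first exact: w0.
by rewrite -w1 big_val; apply: eq_bigr => k _ /=; rewrite enum_valK_in.
Qed.

Lemma conv_hull_convex d n (v : 'I_n -> 'rV[R]_d) (I : finType) (P : pred I)
    (w : I -> R) (u : I -> 'rV[R]_d) : (forall i, P i -> 0 <= w i) ->
  \sum_(i | P i) w i = 1 -> (forall i, P i -> conv_hull v (u i)) ->
  conv_hull v (\sum_(i | P i) w i *: u i).
Proof.
move=> w0 w1 uv.
have /choice[c cP] i : exists c : 'I_n -> R, P i ->
    [/\ forall k, 0 <= c k, \sum_k c k = 1 & \sum_k c k *: v k = u i].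
  have [Pi|] := boolP (P i); last by exists (fun=> 0).
  by have [c [c0 c1] cu] := uv i Pi; exists c.
exists (fun k => \sum_(i | P i) w i * c i k); first split => [k|].
- by apply: sumr_ge0 => i Pi; have [c0 _ _] := cP i Pi; exact/mulr_ge0/c0/w0.
- rewrite exchange_big -w1; apply: eq_bigr => i Pi; have [_ c1 _] := cP i Pi.
  by rewrite -mulr_sumr c1 mulr1.
under eq_bigr do rewrite scaler_suml.
rewrite exchange_big; apply: eq_bigr => i Pi; have [_ _ <-] := cP i Pi.
by rewrite scaler_sumr; apply: eq_bigr => k _; rewrite scalerA.
Qed.

Lemma polytope_convex d (A : set 'rV[R]_d) a b x y : is_polytope A ->
  0 <= a -> 0 <= b -> a + b = 1 -> A x -> A y -> A (a *: x + b *: y).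
Proof.
move=> [n [v ->]] a0 b0 ab Ax Ay.
have := @conv_hull_convex d n v bool xpredT (fun c => if c then a else b)
  (fun c => if c then x else y).
by rewrite !big_bool /=; apply=> // -[].
Qed.

Lemma sum_sign3 (V : nmodType) n (al : 'I_n -> R) (F : 'I_n -> V) : \sum_i F i =
  \sum_(i | 0 < al i) F i + \sum_(i | al i < 0) F i + \sum_(i | al i == 0) F i.
Proof.
rewrite (bigID (fun i => 0 < al i)) /= (bigID (fun i => al i < 0) (fun i => ~~ _)) /= addrA.
by congr (_ + _ + _); apply: eq_bigl => i; case: ltgtP.
Qed.

Lemma sum_pos_neg_ge0 n (w al : 'I_n -> R) : 0 <= \sum_i w i * al i ->
  0 <= \sum_(i | 0 < al i) w i * al i + \sum_(i | al i < 0) w i * al i.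
Proof.
rewrite (sum_sign3 al) [X in _ + X]big1 ?addr0 // => i /eqP ->.
by rewrite mulr0.
Qed.

(* The mass on the points with [al i < 0] is transported onto the crossing
   points, where the segments joining them to the points with [0 < al i] meet
   [al = 0]. *)
Lemma conv_split (V : lmodType R) n (w al : 'I_n -> R) (g : 'I_n -> V) :
  (forall i, 0 <= w i) -> 0 <= \sum_i w i * al i ->
  let p := \sum_(i | 0 < al i) w i * al i in
  let q := \sum_(i | al i < 0) w i * al i in
  \sum_(i | 0 <= al i) (if 0 < al i then w i * (1 + q / p) else w i) *: g i +
  \sum_(ij : 'I_n * 'I_n | (0 < al ij.1) && (al ij.2 < 0))
    (w ij.1 * w ij.2 * (al ij.1 - al ij.2) / p) *:
    ((al ij.1 - al ij.2)^-1 *: (al ij.1 *: g ij.2 - al ij.2 *: g ij.1))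
  = \sum_i w i *: g i.
Proof.
move=> w0 wal p q.
have pq : 0 <= p + q by exact: sum_pos_neg_ge0.
have split2 : \sum_(i | 0 <= al i) (if 0 < al i then w i * (1 + q / p) else w i) *: g i =
    \sum_(i | 0 < al i) (w i * (1 + q / p)) *: g i + \sum_(i | al i == 0) w i *: g i.
  rewrite (bigID (fun i => 0 < al i)) /=; congr (_ + _).
    apply: eq_big => [i|i /andP[_ ->] //]; by case: ltgtP.
  by apply: eq_big => [i|i /andP[_ /negPf ->] //]; case: ltgtP.
rewrite split2 (sum_sign3 al (fun i => w i *: g i)).
(* The pair (i, j) contributes w i * w j / p times al i *: g j - al j *: g i. Summed over i, the
   first term restores the negative part with factor p / p; summed over j, the second leaves - (q /
   p) times the positive part, which cancels the correction in 1 + q / p. *)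
have -> : \sum_(ij : 'I_n * 'I_n | (0 < al ij.1) && (al ij.2 < 0))
    (w ij.1 * w ij.2 * (al ij.1 - al ij.2) / p) *:
    ((al ij.1 - al ij.2)^-1 *: (al ij.1 *: g ij.2 - al ij.2 *: g ij.1)) =
    (p / p) *: (\sum_(i | al i < 0) w i *: g i) -
    (q / p) *: (\sum_(i | 0 < al i) w i *: g i).
  transitivity (\sum_(i | 0 < al i) \sum_(j | al j < 0)
      ((w i * al i / p * w j) *: g j - (w j * al j / p * w i) *: g i)).
    rewrite pair_big /=; apply: eq_bigr => -[i j] /= /andP[ai aj].
    have D0 : al i - al j != 0 by rewrite gt_eqF // subr_gt0 (lt_trans aj).
    rewrite !scalerBr !scalerA; have K a b : a * (al i - al j) / p / (al i - al j) * b = a * b / p.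
      by rewrite (mulrAC a) mulfK // mulrAC.
    by congr (_ *: _ - _ *: _); rewrite K; ring.
  under eq_bigr do rewrite sumrB; rewrite sumrB; congr (_ - _).
    rewrite exchange_big scaler_sumr; apply: eq_bigr => j _.
    by rewrite -scaler_suml -mulr_suml -mulr_suml scalerA.
  rewrite scaler_sumr; apply: eq_bigr => i _.
  by rewrite -scaler_suml -mulr_suml -mulr_suml scalerA.
have -> : \sum_(i | 0 < al i) (w i * (1 + q / p)) *: g i =
    \sum_(i | 0 < al i) w i *: g i + (q / p) *: \sum_(i | 0 < al i) w i *: g i.
  rewrite scaler_sumr -big_split; apply: eq_bigr => i _ /=.
  by rewrite scalerA -scalerDl mulrDr mulr1 [in w i * (q / p)]mulrC.
(* For p = 0 the quotient is 0 by convention. But then 0 <= p + q forces q = 0, so every w i with al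
   i < 0 vanishes and the sum is 0 as well. *)
have -> : (p / p) *: (\sum_(i | al i < 0) w i *: g i) = \sum_(i | al i < 0) w i *: g i.
  have [p0|p0] := eqVneq p 0; last by rewrite divff ?scale1r.
  have q0 : \sum_(i | al i < 0) w i * - al i = 0.
    apply/eqP; rewrite eq_le; apply/andP; split.
      by under eq_bigr do rewrite mulrN; rewrite sumrN oppr_le0; move: pq; rewrite p0 add0r.
    by apply: sumr_ge0 => i /ltW ai; rewrite mulr_ge0 // oppr_ge0.
  rewrite big1 ?scaler0 // => i ai; suff -> : w i = 0 by rewrite scale0r.
  have /eqP : w i * - al i = 0.
    apply: (psumr_eq0P _ q0) => // k /ltW ak; by rewrite mulr_ge0 // oppr_ge0.
  by rewrite mulf_eq0 oppr_eq0 (lt_eqF ai) orbF => /eqP.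
set P := \sum_(i | 0 < al i) _; set N := \sum_(i | al i < 0) _.
set Z := \sum_(i | _ == _) _; set Q := _ *: P.
by rewrite addrACA (addrAC P) -addrA [Z - Q]addrC addNKr.
Qed.

(** The cut is generated by the v i on the nonnegative side together with the crossing points of the
    segments from strictly positive to strictly negative v j; [conv_split] supplies the weights. *)
Lemma is_polytope_cut d (A : set 'rV[R]_d) h :
  is_polytope A -> is_polytope (A `&` halfspace h).
Proof.
move=> [n [v ->]].
pose al i := aff h (v i).
pose P (k : 'I_n + 'I_n * 'I_n) := match k with
  | inl i => 0 <= al i | inr ij => (0 < al ij.1) && (al ij.2 < 0) end.
pose c (g : 'I_n -> 'rV[R]_d) (ij : 'I_n * 'I_n) :=
  (al ij.1 - al ij.2)^-1 *: (al ij.1 *: g ij.2 - al ij.2 *: g ij.1).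
pose u (k : 'I_n + 'I_n * 'I_n) := match k with inl i => v i | inr ij => c v ij end.
suff -> : conv_hull v `&` halfspace h = [set \sum_(i | P i) w i *: u i | w in
    [set w | (forall i, P i -> 0 <= w i) /\ \sum_(i | P i) w i = 1]].
  exact: is_polytope_conv.
apply/seteqP; split => x.
  move=> [[w [w0 w1] <-]]; rewrite /halfspace /= aff_sum // => wal.
  pose p := \sum_(i | 0 < al i) w i * al i.
  pose q := \sum_(i | al i < 0) w i * al i.
  exists (fun k => match k with
    | inl i => if 0 < al i then w i * (1 + q / p) else w i
    | inr ij => w ij.1 * w ij.2 * (al ij.1 - al ij.2) / p end); last first.
    by rewrite big_sumType /= conv_split.
  split; last first.
    rewrite big_sumType /= -[RHS]w1.
    (* With the constant 1 in place of the points, the same identity computes the total of the new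
       weights. *)
    have := @conv_split R^o n w al (fun=> 1) w0 wal; rewrite /= -/p -/q.
    rewrite -[X in _ = X -> _]/(\sum_i w i * 1).
    under [X in _ = X -> _]eq_bigr do rewrite mulr1.
    move=> <-; congr (_ + _); apply: eq_bigr => i; rewrite -[_ *: _]/(_ * _) ?mulr1 //.
    move=> /andP[a1 a2]; have D0 : al i.1 - al i.2 != 0.
      by rewrite gt_eqF // subr_gt0 (lt_trans a2).
    have -> : (al i.1 - al i.2)^-1 *: (al i.1 *: (1 : R^o) - al i.2 *: 1) = 1.
      by rewrite -scalerBl scalerA mulVf // scale1r.
    by rewrite mulr1.
  have p0 : 0 <= p by apply: sumr_ge0 => i /ltW ai; exact: mulr_ge0.
  have pq : 0 <= p + q by exact: sum_pos_neg_ge0.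
  case=> [i|[i j]] /= => [ai|/andP[ai aj]].
    case: ifP => // _; apply: mulr_ge0 => //.
    have [->|pn] := eqVneq p 0; first by rewrite invr0 mulr0 addr0.
    by rewrite -(mulfV pn) -mulrDl divr_ge0.
  by rewrite divr_ge0 // !mulr_ge0 // subr_ge0 ltW // (lt_trans aj).
move=> [w [w0 w1] <-].
have uP k : P k -> conv_hull v (u k) /\ 0 <= aff h (u k).
  have vP i : conv_hull v (v i).
    exists (fun m => (m == i)%:R); first split => [m /=|]; rewrite ?ler0n //.
      by rewrite (bigD1 i) //= eqxx big1 ?addr0 // => m /negPf ->.
    by rewrite (bigD1 i) //= eqxx scale1r big1 ?addr0 // => m /negPf ->; rewrite scale0r.
  case: k => [i|[i j]] /= => [ai|/andP[ai aj]]; first by split => //; exact: vP.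
  have D0 : 0 < al i - al j by rewrite subr_gt0 (lt_trans aj).
  have -> : c v (i, j) = (al i / (al i - al j)) *: v j + (- al j / (al i - al j)) *: v i.
    by rewrite /c /= scalerBr !scalerA mulNr scaleNr; congr (_ *: _ - _ *: _); rewrite mulrC.
  have D1 : al i / (al i - al j) + - al j / (al i - al j) = 1.
    by rewrite -mulrDl divff // gt_eqF.
  split.
    apply: polytope_convex => //; [by exists n, v| | ].
      by rewrite divr_ge0 // ltW.
    by rewrite divr_ge0 // ?(ltW D0) // oppr_ge0 ltW.
  by rewrite aff_comb // -/(al _) -/(al _) le_eqVlt; apply/orP; left; apply/eqP; ring.
split; first by apply: conv_hull_convex => // k /uP[].
rewrite /halfspace /= aff_sum //; apply: sumr_ge0 => k Pk; apply: mulr_ge0; first exact: w0.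
by have [] := uP k Pk.
Qed.

Definition cone_hull m n (v : 'I_n -> 'rV[R]_m) : set 'rV[R]_m :=
  [set \sum_i w i *: v i | w in [set w : 'I_n -> R | forall i, 0 <= w i]].

(* Fourier-Motzkin elimination, one generator at a time. *)
Lemma cone_hull_halfspaces m n (v : 'I_n -> 'rV[R]_m) :
  exists L : seq 'cV[R]_m,
    cone_hull v = [set x | forall l, l \in L -> 0 <= (x *m l) 0 0].
Proof.
elim: n v => [|n IH] v.
  exists ([seq delta_mx i 0 | i <- enum 'I_m] ++ [seq - delta_mx i 0 | i <- enum 'I_m]).
  apply/seteqP; split => x /=.
    by move=> [w _ <-] l _; rewrite big_ord0 mul0mx mxE.
  move=> H; exists (fun=> 0) => //; rewrite big_ord0; apply/rowP => i; rewrite mxE.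
  have E (y : 'rV[R]_m) : (y *m delta_mx i 0 : 'M[R]_1) 0 0 = y 0 i.
    by rewrite -colE mxE.
  apply/le_anti/andP; split.
    have := H (delta_mx i 0); rewrite E; apply.
    by rewrite mem_cat; apply/orP; left; apply/mapP; exists i; rewrite ?mem_enum.
  have := H (- delta_mx i 0); rewrite mulmxN mxE E oppr_ge0; apply.
  by rewrite mem_cat; apply/orP; right; apply/mapP; exists i; rewrite ?mem_enum.
have [L vL] := IH (fun i => v (lift ord0 i)).
pose be (l : 'cV[R]_m) := (v ord0 *m l) 0 0.
exists ([seq l <- L | 0 <= be l] ++
  [seq be l *: l' - be l' *: l | l <- [seq l <- L | 0 < be l], l' <- [seq l <- L | be l < 0]]).
(* t is the coefficient of the new generator [v ord0], the variable to be eliminated. *)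
have S (x : 'rV[R]_m) : cone_hull v x <->
    exists2 t, 0 <= t & forall l, l \in L -> 0 <= (x *m l) 0 0 - t * be l.
  have <- : (exists2 t, 0 <= t & cone_hull (fun i => v (lift ord0 i)) (x - t *: v ord0)) <->
      exists2 t, 0 <= t & forall l, l \in L -> 0 <= (x *m l) 0 0 - t * be l.
    have M l t : ((x - t *: v ord0) *m l) 0 0 = (x *m l) 0 0 - t * be l.
      by rewrite /be mulmxBl -scalemxAl mx11_subZ.
    by rewrite vL; split=> -[t t0 H]; exists t => // l lL; have := H l lL; rewrite /= M.
  split.
    move=> [w w0 <-]; exists (w ord0) => //; exists (fun i => w (lift ord0 i)) => //.
    by rewrite big_ord_recl addrAC subrr add0r.
  move=> [t t0 [w w0 wE]].
  exists (fun i => if unlift ord0 i is Some j then w j else t).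
    by move=> i; case: (unliftP ord0 i).
  rewrite big_ord_recl unlift_none; under eq_bigr do rewrite liftK.
  by rewrite wE addrC subrK.
have bigE a b (x : 'rV[R]_m) (l l' : 'cV[R]_m) :
    (x *m (a *: l - b *: l') : 'M[R]_1) 0 0 = a * (x *m l) 0 0 - b * (x *m l') 0 0.
  by rewrite mulmxBr -!scalemxAr mx11_subZ mx11_Z.
apply/seteqP; split => x.
  move/S => [t t0 H] l; rewrite mem_cat => /orP[|/allpairsP[[l1 l2] /=]].
    rewrite mem_filter => /andP[b0 lL]; have := H l lL.
    by rewrite subr_ge0; apply: le_trans; exact: mulr_ge0.
  rewrite !mem_filter => -[/andP[b1 /H H1] /andP[b2 /H H2] ->].
  by rewrite bigE; nra.
move=> H; apply/S.
(* Inequalities with be l < 0 bound t from below, those with be l > 0 from above. The largest lower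
   bound, 0 included, is chosen; the combined inequalities say that it respects every upper
   bound. *)
exists (\big[Num.max/0]_(l <- L | be l < 0) ((x *m l) 0 0 / be l)).
  exact: bigmax_ge_id.
move=> l lL; rewrite subr_ge0.
have [bl|bl|bl] := ltgtP (be l) 0.
- by rewrite -ler_ndivrMr //; apply: le_bigmax_seq lL _.
- rewrite -ler_pdivlMr //; rewrite big_seq_cond; apply: bigmax_le => [|l' /andP[l'L bl']].
    by rewrite divr_ge0 ?(ltW bl) // H // mem_cat mem_filter (ltW bl) lL.
  have := H (be l *: l' - be l' *: l); rewrite bigE mem_cat => H'.
  have {}H' : 0 <= be l * (x *m l') 0 0 - be l' * (x *m l) 0 0.
    apply: H'; apply/orP; right; apply/allpairsP; exists (l, l').
    by rewrite !mem_filter /= bl bl' lL l'L.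
  rewrite ler_pdivlMr // mulrAC ler_ndivrMr //; nra.
- by rewrite bl mulr0 H // mem_cat mem_filter bl lexx lL.
Qed.

End PolytopeGeometry.

(** * Polytopes as intersections of half-spaces; prisms, boxes, interior points *)

Section PolytopeConstructions.
Context {R : realType}.

(** Homogenisation: A is the slice at height 1 of the cone over the points (1, v i), and a linear
    inequality of the cone restricts to an affine one whose constant is its head coefficient. *)
Lemma polytope_halfspaces d (A : set 'rV[R]_d) : is_polytope A ->
  exists L : seq ('cV[R]_d * R), A = [set x | forall h, h \in L -> 0 <= aff h x].
Proof.
move=> [n [v ->]].
have [L vL] := cone_hull_halfspaces (fun i => cons_rv 1 (v i)).
pose hl (l : 'cV[R]_d.+1) : 'cV[R]_d * R := (\col_j l (lift ord0 j) 0, l ord0 0).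
have hlE l x : (cons_rv 1 x *m l) 0 0 = aff (hl l) x.
  rewrite /aff !row_mulE big_ord_recl cons_rv0 mul1r addrC; congr (_ + _).
  by apply: eq_bigr => j _; rewrite cons_rvS mxE.
exists [seq hl l | l <- L].
have sumE (w : 'I_n -> R) : \sum_i w i *: cons_rv 1 (v i) =
    cons_rv (\sum_i w i) (\sum_i w i *: v i).
  apply/rowP => j; rewrite summxE; case: (unliftP ord0 j) => [k|] ->.
    by rewrite cons_rvS summxE; apply: eq_bigr => i _; rewrite mxE cons_rvS mxE.
  by rewrite cons_rv0; apply: eq_bigr => i _; rewrite mxE cons_rv0 mulr1.
transitivity [set x | cone_hull (fun i => cons_rv 1 (v i)) (cons_rv 1 x)]; last first.
  rewrite vL; apply/seteqP; split => x /= H.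
    by move=> _ /mapP[l lL ->]; rewrite -hlE; exact: H.
  by move=> l lL; rewrite hlE; apply: H; exact: map_f.
apply/seteqP; split => x [w].
  by move=> [w0 w1] <-; exists w => //; rewrite sumE w1.
move=> /= w0; rewrite sumE => /rowP E; exists w.
  by split=> //; have := E ord0; rewrite !cons_rv0.
by apply/rowP => j; have := E (lift ord0 j); rewrite !cons_rvS.
Qed.

(** The intermediate intersections may be unbounded, hence K speaks of arbitrary sets; where
    polytopes are required, K intersects with a fixed one. *)
Lemma halfspaces_ind d (A : set 'rV[R]_d) (K : set 'rV[R]_d -> Prop) :
  is_polytope A -> K setT -> (forall B h, K B -> K (B `&` halfspace h)) -> K A.
Proof.
move=> /polytope_halfspaces[L ->] KT KI; elim: L => [|h L IH].
  by rewrite (_ : [set x | _] = setT) //; apply/seteqP; split => x.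
rewrite (_ : [set x | _] = [set x | forall h, h \in L -> 0 <= aff h x] `&` halfspace h).
  exact: KI.
apply/seteqP; split => x /=.
  by move=> H; split => [k kL|]; apply: H; rewrite inE ?kL ?orbT ?eqxx.
by move=> [H1 H2] k; rewrite inE => /orP[/eqP -> //|/H1].
Qed.

Lemma is_polytopeI d (A B : set 'rV[R]_d) :
  is_polytope A -> is_polytope B -> is_polytope (A `&` B).
Proof.
move=> pA pB; apply: (halfspaces_ind (K := fun B => is_polytope (A `&` B)) pB).
  by rewrite setIT.
by move=> X h; rewrite setIA; exact: is_polytope_cut.
Qed.

Lemma polytope_measurable d (A : set 'rV[R]_d) : is_polytope A -> coord_measurable A.
Proof.
move/halfspaces_ind; apply; first exact: coord_measurableT.
by move=> B h mB; apply: coord_measurableI => //; exact: coord_measurable_halfspace.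
Qed.

Lemma is_polytope_affine d (A : set 'rV[R]_d) a b :
  is_polytope A -> is_polytope [set a *: x + b | x in A].
Proof.
move=> [n [v ->]]; exists n, (fun i => a *: v i + b).
have E (w : 'I_n -> R) : \sum_i w i = 1 ->
    a *: (\sum_i w i *: v i) + b = \sum_i w i *: (a *: v i + b).
  move=> w1; under [RHS]eq_bigr do rewrite scalerDr scalerA mulrC -scalerA.
  by rewrite big_split /= -scaler_suml w1 scale1r -scaler_sumr.
apply/seteqP; split => x /=.
  by move=> [_ [w [w0 w1] <-] <-]; exists w => //; rewrite E.
by move=> [w [w0 w1] <-]; exists (\sum_i w i *: v i); [exists w|exact: E].
Qed.

Definition prism_set d (A : set 'rV[R]_d) (u : 'rV[R]_d) : set 'rV[R]_d :=
  [set z | exists x t, [/\ A x, 0 <= t <= 1 & z = x + t *: u]].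

(** Generated by two copies of the v i, the second shifted by u; the parameter t is the total weight
    of the shifted copy. *)
Lemma is_polytope_prism d (A : set 'rV[R]_d) u :
  is_polytope A -> is_polytope (prism_set A u).
Proof.
move=> [n [v ->]].
suff -> : prism_set (conv_hull v) u = [set \sum_(k | predT k) w k *: (v k.1 + k.2%:R *: u) | w in
    [set w : 'I_n * bool -> R | (forall k, predT k -> 0 <= w k) /\ \sum_(k | predT k) w k = 1]].
  exact: is_polytope_conv.
have S (V : nmodType) (F : 'I_n -> bool -> V) :
    \sum_(k | predT k) F k.1 k.2 = \sum_i (F i true + F i false).
  rewrite -(pair_bigA _ F); apply: eq_bigr => i _; exact: big_bool.
apply/seteqP; split => x /=.
  move=> [_ [t [[w [w0 w1] <-] /andP[t0 t1] ->]]].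
  have tt : t + (1 - t) = 1 by rewrite addrC subrK.
  exists (fun k => w k.1 * if k.2 then t else 1 - t).
    split=> [[i []] _ /=|]; first by rewrite mulr_ge0.
      by rewrite mulr_ge0 // subr_ge0.
    rewrite (S _ (fun i b => w i * (if b then t else 1 - t))) -[RHS]w1.
    by apply: eq_bigr => i _; rewrite -mulrDr tt mulr1.
  rewrite (S _ (fun i b => (w i * (if b then t else 1 - t)) *: (v i + b%:R *: u))) /=.
  rewrite -[t *: u]scale1r -[X in X *: (t *: u)]w1 scaler_suml -big_split.
  apply: eq_bigr => i _ /=.
  by rewrite scale0r addr0 scale1r scalerDr addrAC -scalerDl -mulrDr tt mulr1 scalerA.
move=> [w [w0 w1] <-].
have wE : \sum_(k | predT k) w k = \sum_i (w (i, true) + w (i, false)).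
  by rewrite -(S _ (fun i b => w (i, b))); apply: eq_bigr => -[].
move: w1; rewrite wE big_split => w1.
exists (\sum_i (w (i, true) + w (i, false)) *: v i), (\sum_i w (i, true)); split.
- exists (fun i => w (i, true) + w (i, false)) => //; split; last by rewrite big_split.
  by move=> i; rewrite addr_ge0 ?w0.
- have w0b b : 0 <= \sum_i w (i, b) by apply: sumr_ge0 => i _; exact: w0.
  by rewrite w0b -w1 lerDl w0b.
rewrite scaler_suml -big_split /=.
transitivity (\sum_(k | predT k) w (k.1, k.2) *: (v k.1 + k.2%:R *: u)).
  by apply: eq_bigr => -[].
rewrite (S _ (fun i b => w (i, b) *: (v i + b%:R *: u))); apply: eq_bigr => i _ /=.
by rewrite scale1r scale0r addr0 scalerDr scalerDl addrAC.
Qed.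

(** An iterated prism over the origin, one coordinate axis at a time. *)
Lemma is_polytope_box d (a : 'I_d -> R) : (forall i, 0 <= a i) ->
  is_polytope [set x : 'rV[R]_d | forall i, 0 <= x 0 i <= a i].
Proof.
move=> a0.
suff H m : (m <= d)%N -> is_polytope [set x : 'rV[R]_d | forall i : 'I_d,
    if (i < m)%N then 0 <= x 0 i <= a i else x 0 i == 0].
  have := H d (leqnn d); congr is_polytope; apply/seteqP; split => x /= E i;
    by have := E i; rewrite ltn_ord.
elim: m => [_|m IH md].
  exists 1%N, (fun=> 0); apply/seteqP; split => x /=.
    move=> E; exists (fun=> 1); first by split=> [i|]; rewrite ?ler01 // big_ord_recl big_ord0 addr0.
    rewrite big1; last by move=> *; rewrite scaler0.
    by apply/rowP => i; rewrite mxE; apply/esym/eqP/E.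
  by move=> [w _ <-] i; rewrite big1 ?mxE // => *; rewrite scaler0.
pose k := Ordinal md.
have := is_polytope_prism (a k *: delta_mx 0 k) (IH (ltnW md)).
have dE (i : 'I_d) : (delta_mx 0 k : 'rV[R]_d) 0 i = (i == k)%:R by rewrite mxE eqxx.
have ki (i : 'I_d) : (i < m.+1)%N = (i < m)%N || (i == k).
  by rewrite ltnS leq_eqVlt orbC -val_eqE.
congr is_polytope; apply/seteqP; split => x /=.
  move=> [y [t [yE /andP[t0 t1] ->]]] i; have := yE i.
  rewrite ki !mxE eqxx /= mulrA; have [->|_] := eqVneq i k; last first.
    by rewrite mulr0 addr0 orbF.
  by rewrite ltnn /= => /eqP ->; rewrite add0r ?mulr1n mulr1 mulr_ge0 //= ler_piMl.
move=> E.
have /andP[xk0 xka] : 0 <= x 0 k <= a k by have := E k; rewrite ltnSn.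
exists (x - x 0 k *: delta_mx 0 k), (x 0 k / a k); split.
- move=> i; have := E i; rewrite ki !mxE eqxx /=; have [->|_] := eqVneq i k.
    by rewrite ltnn orbT /= ?mulr1n mulr1 subrr eqxx.
  by rewrite /= ?mulr0n mulr0 subr0 orbF.
- rewrite divr_ge0 //=; have [->|ak] := eqVneq (a k) 0; first by rewrite invr0 mulr0.
  by rewrite ler_pdivrMr ?mul1r // lt_neqAle eq_sym ak a0.
- rewrite scalerA; have [ak|ak] := eqVneq (a k) 0; last by rewrite mulfVK // subrK.
  have -> : x 0 k = 0 by apply/le_anti; rewrite xk0 -ak xka.
  by rewrite mul0r !mul0r subrK.
Qed.

Lemma polytope_bounded d (A : set 'rV[R]_d) : is_polytope A ->
  exists2 M : R, 0 < M & forall x, A x -> forall i, `|x 0 i| <= M.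
Proof.
move=> [n [v ->]]; pose M := \sum_k \sum_i `|v k 0 i|.
have M0 : 0 <= M by apply: sumr_ge0 => k _; exact: sumr_ge0.
exists (M + 1) => [|_ [w [w0 w1] <-] i]; first by rewrite ltr_wpDl.
apply: le_trans (_ : M <= _); last by rewrite lerDl.
rewrite summxE; apply: le_trans (ler_norm_sum _ _ _) _; apply: ler_sum => k _.
rewrite mxE normrM ger0_norm // [leRHS](bigD1 i) //=.
apply: ler_wpDr; first exact: sumr_ge0.
by rewrite ler_piMl // -w1 (bigD1 k) //= lerDl; exact: sumr_ge0.
Qed.

(** Degeneracy by a single affine equation, the form in which cuts and volume meet it;
    [flat_affine_dim] and [affine_dim_flat] relate it to dimension. *)
Definition flat d (A : set 'rV[R]_d) :=
  exists2 h : 'cV[R]_d * R, h.1 != 0 & forall x, A x -> aff h x = 0.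

(** If A is not flat, each half-space with nonzero linear part is satisfied strictly somewhere on A,
    and taking midpoints repeatedly satisfies all of them strictly at one point p. A sup-norm ball
    whose radius is controlled by the slack at p then stays inside. *)
Lemma flat_or_interior d (A : set 'rV[R]_d) : is_polytope A -> A !=set0 ->
  flat A \/ exists (p : 'rV[R]_d) (e : R), 0 < e /\
    forall x : 'rV[R]_d, (forall i, `|x 0 i| <= e) -> A (p + x).
Proof.
move=> pA [x0 Ax0]; have [L AL] := polytope_halfspaces pA.
have [Af|nf] := pselect (flat A); [by left|right].
have H1 (L' : seq ('cV[R]_d * R)) : {subset L' <= L} ->
    exists2 p, A p & forall h, h \in L' -> h.1 != 0 -> 0 < aff h p.
  elim: L' => [|h L' IH] sL; first by exists x0.
  have [p Ap pL] : exists2 p, A p & forall h, h \in L' -> h.1 != 0 -> 0 < aff h p.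
    by apply: IH => k kL; apply: sL; rewrite inE kL orbT.
  have geL k y : k \in L -> A y -> 0 <= aff k y by rewrite AL => kL; exact.
  have [h0|h0] := eqVneq h.1 0.
    by exists p => // k; rewrite inE => /orP[/eqP ->|/pL //]; rewrite h0 eqxx.
  have [q Aq hq] : exists2 q, A q & 0 < aff h q.
    apply: contrapT => nq; apply: nf; exists h => // x Ax; apply/eqP.
    rewrite eq_le geL ?andbT ?sL ?inE ?eqxx // leNgt; apply/negP => hx.
    by apply: nq; exists x.
  have hf : (2^-1 : R) + 2^-1 = 1 by field.
  exists (2^-1 *: p + 2^-1 *: q) => [|k kL k0].
    by apply: polytope_convex => //; rewrite invr_ge0.
  rewrite aff_comb // -mulrDr mulr_gt0 ?invr_gt0 //.
  move: kL; rewrite inE => /orP[/eqP ->|kL].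
    by rewrite ltr_wpDl // geL // sL // inE eqxx.
  by rewrite ltr_pwDl ?pL // geL // sL // inE kL orbT.
have [p Ap pL] := H1 L (fun _ => id).
have [e e0 eL] : exists2 e, 0 < e &
    forall h, h \in L -> h.1 != 0 -> e * \sum_i `|h.1 i 0| <= aff h p.
  elim: (L) pL => [_|h L' IH pL]; first by exists 1.
  have [e e0 eL] : exists2 e, 0 < e &
      forall h, h \in L' -> h.1 != 0 -> e * \sum_i `|h.1 i 0| <= aff h p.
    by apply: IH => k kL; apply: pL; rewrite inE kL orbT.
  have S0 (k : 'cV[R]_d * R) : 0 <= \sum_i `|k.1 i 0| by exact: sumr_ge0.
  have [h0|h0] := eqVneq h.1 0.
    by exists e => // k; rewrite inE => /orP[/eqP ->|/eL //]; rewrite h0 eqxx.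
  have hp : 0 < aff h p by apply: pL => //; rewrite inE eqxx.
  have S1 : 0 < 1 + \sum_i `|h.1 i 0| by rewrite ltr_pwDl.
  exists (Num.min e (aff h p / (1 + \sum_i `|h.1 i 0|))).
    by rewrite lt_min e0 divr_gt0.
  move=> k; rewrite inE => /orP[/eqP -> _|kL k0].
    apply: le_trans (_ : aff h p / (1 + \sum_i `|h.1 i 0|) * (1 + \sum_i `|h.1 i 0|) <= _).
      apply: ler_pM => //; last by rewrite lerDr.
        by rewrite ltW // lt_min e0 divr_gt0.
      by rewrite ge_min lexx orbT.
    by rewrite divfK // gt_eqF.
  apply: le_trans (eL k kL k0); apply: ler_wpM2r => //.
  by rewrite ge_min lexx.
exists p, e; split => // x xe; rewrite AL => h hL.
have -> : aff h (p + x) = aff h p + (x *m h.1) 0 0 by rewrite /aff mulmxDl mxE addrAC.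
have [h0|h0] := eqVneq h.1 0.
  by rewrite h0 mulmx0 mxE addr0; move: Ap; rewrite AL; exact.
rewrite -[X in _ + X]opprK subr_ge0; apply: le_trans (eL h hL h0).
apply: le_trans (ler_norm _) _; rewrite normrN row_mulE mulr_sumr.
apply: le_trans (ler_norm_sum _ _ _) _; apply: ler_sum => i _.
by rewrite normrM ler_wpM2r.
Qed.

End PolytopeConstructions.

(** * Volume of polytopes and closed cones *)

Section Volume.
Context {R : realType}.

Lemma affine_imageE d (A : set 'rV[R]_d) a b : a != 0 ->
  [set a *: x + b | x in A] = [set y | A (a^-1 *: y + - (a^-1 *: b))].
Proof.
move=> a0; apply/seteqP; split => y /=.
  by move=> [x Ax <-]; rewrite scalerDr scalerA mulVf // scale1r addrK.
move=> Ay; exists (a^-1 *: y - a^-1 *: b) => //.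
by rewrite scalerBr !scalerA divff // !scale1r subrK.
Qed.

Lemma lebesgue_vol_affine_image d (A : set 'rV[R]_d) a b : 0 < a -> is_polytope A ->
  lebesgue_vol [set a *: x + b | x in A] = ((a ^+ d)%:E * lebesgue_vol A)%E.
Proof.
move=> a0 pA; rewrite affine_imageE ?gt_eqF // lebesgue_vol_affine ?invr_gt0 ?invrK //.
exact: polytope_measurable.
Qed.

Definition cube d (s : R) : set 'rV[R]_d := [set x | forall i, 0 <= x 0 i <= s].
Arguments cube : clear implicits.

Lemma is_polytope_cube d s : 0 <= s -> is_polytope (cube d s).
Proof. by move=> s0; exact: is_polytope_box. Qed.

Lemma lebesgue_vol_fin_num d (A : set 'rV[R]_d) : is_polytope A ->
  lebesgue_vol A \is a fin_num.
Proof.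
move=> pA; have [M M0 AM] := polytope_bounded pA.
pose b : 'rV[R]_d := const_mx (- M).
rewrite ge0_fin_numE ?lebesgue_vol_ge0 //.
have pc := is_polytope_cube d (ler01 : 0 <= 1 :> R).
have M2 : 0 < 2 * M by rewrite mulr_gt0.
pose S := [set (2 * M) *: x + b | x in cube d 1].
apply: (@le_lt_trans _ _ (lebesgue_vol S)); rewrite /S.
  apply: lebesgue_vol_le.
  - exact: polytope_measurable.
  - exact/polytope_measurable/is_polytope_affine.
  - rewrite affine_imageE ?gt_eqF // => x Ax i /=; rewrite !mxE.
    have := AM x Ax i; rewrite ler_norml => /andP[xl xr].
    have -> : (2 * M)^-1 * x 0 i - (2 * M)^-1 * - M = (x 0 i + M) / (2 * M).
      by rewrite mulrN opprK -mulrDr mulrC.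
    by rewrite divr_ge0 ?ler_pdivrMr // ?mul1r; lra.
by rewrite lebesgue_vol_affine_image // lebesgue_vol_cube mule1 ltry.
Qed.

Lemma volE d (P : polytope R d) : lebesgue_vol P = (vol P)%:E.
Proof. by rewrite /vol fineK // lebesgue_vol_fin_num //; exact: psetP. Qed.

Lemma volUI d (P Q U I : polytope R d) : pset U = pset P `|` pset Q ->
  pset I = pset P `&` pset Q -> vol U + vol I = vol P + vol Q.
Proof.
move=> UE IE; have := @lebesgue_volUI _ _ P Q
  (polytope_measurable (psetP P)) (polytope_measurable (psetP Q)).
rewrite -UE -IE !volE.
by rewrite -!EFinD => -[].
Qed.

Lemma vol_ge0 d (P : polytope R d) : 0 <= vol P.
Proof. exact/fine_ge0/lebesgue_vol_ge0. Qed.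

Lemma vol_affine d (P Q : polytope R d) a b : 0 < a ->
  pset Q = [set a *: x + b | x in P] -> vol Q = a ^+ d * vol P.
Proof.
move=> a0 QE; have := lebesgue_vol_affine_image b a0 (psetP P).
by rewrite -QE !volE -EFinM => -[].
Qed.

Lemma vol_flat d (P : polytope R d) : flat P -> vol P = 0.
Proof.
move=> [h h0 Ph]; suff -> : vol P = fine (0 : \bar R) by [].
congr fine; apply/le_anti/andP; split; last exact: lebesgue_vol_ge0.
have pz : [set x | aff h x = 0] = halfspace h `&` halfspace (aff_opp h).
  apply/seteqP; split => x /=; rewrite /halfspace /= aff_oppE oppr_ge0.
    by move->; rewrite lexx.
  by move=> [x0 x1]; apply/le_anti; rewrite x0 x1.
rewrite -(lebesgue_vol_hyperplane h.2 h0); apply: lebesgue_vol_le => //.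
  exact/polytope_measurable/psetP.
rewrite -[[set x | _]]/[set x | aff h x = 0] pz.
by apply: coord_measurableI; exact: coord_measurable_halfspace.
Qed.

Lemma vol_cube d (P : polytope R d) : pset P = cube d 1 -> vol P = 1.
Proof. by move=> PE; rewrite /vol PE lebesgue_vol_cube. Qed.

End Volume.

Arguments cube {R} d s.

Section ConeTheory.
Context {R : realType} {G : vectType R} (C : set G).
Hypotheses (C_cone : convex_cone C) (C_closed : vect_closed C).

Lemma cone_0 : C 0. Proof. by case: C_cone. Qed.
Lemma cone_add x y : C x -> C y -> C (x + y). Proof. by case: C_cone => _ + _; apply. Qed.
Lemma cone_scale (a : R) x : 0 <= a -> C x -> C (a *: x).
Proof. by case: C_cone => _ _; apply. Qed.

Lemma cone_sum (I : finType) (P : pred I) (F : I -> G) :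
  (forall i, P i -> C (F i)) -> C (\sum_(i | P i) F i).
Proof. by move=> CF; elim/big_rec: _ => [|i x Pi]; [exact: cone_0|exact/cone_add/CF]. Qed.

(** For k > 0 the vectors x + y / k lie in C and tend to x. This replaces every passage to the limit
    in the proof. *)
Lemma cone_archimedean x y : (forall k : nat, C (y + k%:R *: x)) -> C x.
Proof.
move=> H; pose r (z : G) := \row_i coord (vbasis {:G}) i z.
suff : [set r z | z in C] (r x).
  move=> [c Cc /rowP rc]; rewrite (_ : x = c) //.
  rewrite (coord_vbasis (memvf x)) (coord_vbasis (memvf c)).
  by apply: eq_bigr => i _; have := rc i; rewrite !mxE => ->.
apply: C_closed => B /nbhs_ballP[e /= e0 eB].
pose M := \sum_i `|r y 0 i|.
have M0 : 0 <= M by exact: sumr_ge0.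
pose k := (Num.bound (M / e)).+1.
have kM : M / e < k%:R.
  apply: lt_trans (archi_boundP _) _; first by rewrite divr_ge0 // ltW.
  by rewrite ltr_nat.
have k0 : 0 < k%:R :> R by rewrite ltr0n.
exists (r (x + k%:R^-1 *: y)); split.
  exists (x + k%:R^-1 *: y) => //.
  have -> : x + k%:R^-1 *: y = k%:R^-1 *: (y + k%:R *: x).
    by rewrite scalerDr scalerA mulVf ?gt_eqF // scale1r addrC.
  by apply: cone_scale; [rewrite invr_ge0 ltW|exact: H].
apply: eB; split=> // i j; rewrite (ord1 i) /ball /= !mxE linearD linearZ /= opprD addNKr normrN.
rewrite normrM gtr0_norm ?invr_gt0 // mulrC ltr_pdivrMr //.
have : `|r y 0 j| <= M by rewrite /M (bigD1 j) //= lerDl sumr_ge0.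
rewrite mxE => /le_lt_trans; apply.
by move: kM; rewrite ltr_pdivrMr // mulrC.
Qed.

End ConeTheory.

(** * Nonnegative valuations vanishing on flat polytopes *)

Section SimplePositive.
Context {R : realType} {d : nat} {G : vectType R} (C : set G).
Hypothesis C_cone : convex_cone C.
Implicit Types (phi : polytope R d -> G) (A B : set 'rV[R]_d).

(* Extension of [phi] to all sets, by the junk value [0] on non-polytopes. *)
Definition on_set phi A : G :=
  if pselect (is_polytope A) is left p then phi (Polytope p) else 0.

Lemma on_setE phi P : on_set phi (pset P) = phi P.
Proof.
rewrite /on_set; case: pselect => [p|[]]; last exact: psetP.
by congr phi; exact: pset_inj.
Qed.

(** Valuations vanishing on flat polytopes are usually called simple. Combinatorially positive
    valuations and [scaled_vol c] with c in C both have these properties, so the comparison can be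
    run in either direction. *)
Definition simple_positive phi :=
  [/\ is_valuation phi, (forall P, C (phi P)) & (forall P : polytope R d, flat P -> phi P = 0)].

Section OneValuation.
Context (phi : polytope R d -> G) (phiP : simple_positive phi).
Local Notation v := (on_set phi).

Lemma on_set_ge0 A : C (v A).
Proof.
have [_ p0 _] := phiP; rewrite /on_set; case: pselect => // _.
exact: (cone_0 C_cone).
Qed.

Lemma on_set_flat A : flat A -> v A = 0.
Proof. by have [_ _ f0] := phiP; rewrite /on_set; case: pselect => // pA fA; exact: f0. Qed.

Lemma on_set0 : v set0 = 0.
Proof.
by have [[e0 _ _] _ _] := phiP; rewrite /on_set; case: pselect => // p; exact: e0.
Qed.

Lemma on_set_translate t A : is_polytope A -> v [set t + x | x in A] = v A.
Proof.
move=> pA; have [[_ _ tr] _ _] := phiP.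
by rewrite -[A]/(pset (Polytope pA)) -[[set _ | _ in _]]/(pset (translate t (Polytope pA))) !on_setE.
Qed.

Lemma on_set_cut A h : is_polytope A -> h.1 != 0 ->
  v A = v (A `&` halfspace h) + v (A `&` halfspace (aff_opp h)).
Proof.
move=> pA h0; have [[_ add _] _ f0] := phiP.
pose P := Polytope (is_polytope_cut h pA).
pose Q := Polytope (is_polytope_cut (aff_opp h) pA).
pose I := Polytope (is_polytope_cut (aff_opp h) (is_polytope_cut h pA)).
rewrite -[A]/(pset (Polytope pA)) -[X in _ = v X + _]/(pset P) -[X in _ = _ + v X]/(pset Q) !on_setE.
rewrite -(add P Q (Polytope pA) I) /=.
- rewrite (f0 I) ?addr0 //; exists h => // x [[_]].
  rewrite /halfspace /= aff_oppE oppr_ge0 => x0 x1.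
  by apply/le_anti; rewrite x0 x1.
- rewrite -setIUr [_ `|` _](_ : _ = setT) ?setIT //; apply/seteqP; split => // x _.
  rewrite /halfspace /= aff_oppE oppr_ge0.
  by have [|/ltW] := lerP 0 (aff h x); [left|right].
- by rewrite setIACA setIid setIA.
Qed.

Lemma on_set_le A B : is_polytope A -> is_polytope B -> B `<=` A -> C (v A - v B).
Proof.
move=> pA pB BA; rewrite -(setIidr BA).
suff [_ //] : is_polytope (A `&` B) /\ C (v A - v (A `&` B)).
(* Intersecting with A keeps the sets of the induction polytopes; each cut discards a piece whose
   value lies in C. *)
apply: (halfspaces_ind (K := fun B => is_polytope (A `&` B) /\ C (v A - v (A `&` B))) pB).
  by rewrite setIT subrr; split=> //; exact: (cone_0 C_cone).
move=> X h [pX XC]; rewrite setIA; split; first exact: is_polytope_cut.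
have [h0|h0] := eqVneq h.1 0; last first.
  have E := on_set_cut pX h0.
  have -> : v A - v (A `&` X `&` halfspace h) =
      (v A - v (A `&` X)) + v (A `&` X `&` halfspace (aff_opp h)).
    by rewrite E opprD addrA subrK.
  exact/(cone_add C_cone)/on_set_ge0.
have hE x : aff h x = h.2 by rewrite /aff h0 mulmx0 mxE add0r.
have [h2|h2] := lerP 0 h.2.
  rewrite (_ : halfspace h = setT) ?setIT //.
  by apply/seteqP; split => x //; rewrite /halfspace /= hE.
rewrite (_ : halfspace h = set0) ?setI0 ?on_set0 ?subr0; first exact: on_set_ge0.
by apply/seteqP; split => x //; rewrite /halfspace /= hE leNgt h2.
Qed.

Definition slab (i : 'I_d) (a b : R) : set 'rV[R]_d := [set x | a <= x 0 i <= b].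

Definition coord_aff (i : 'I_d) (c : R) : 'cV[R]_d * R := (delta_mx i 0, - c).

Lemma coord_affE i c (x : 'rV_d) : aff (coord_aff i c) x = x 0 i - c.
Proof. by rewrite /aff /= -colE mxE. Qed.

Lemma coord_aff_neq0 i c : (coord_aff i c).1 != 0.
Proof.
apply/eqP => /colP /(_ i) /=; rewrite !mxE !eqxx /= => /eqP.
by rewrite oner_eq0.
Qed.

Lemma slab_halfspaces i a b :
  slab i a b = halfspace (coord_aff i a) `&` halfspace (aff_opp (coord_aff i b)).
Proof.
apply/seteqP; split => x; rewrite /slab /halfspace /= aff_oppE !coord_affE subr_ge0 oppr_ge0 subr_le0.
  by move/andP.
by move=> [-> ->].
Qed.

Lemma is_polytope_slab A i a b : is_polytope A -> is_polytope (A `&` slab i a b).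
Proof. by move=> pA; rewrite slab_halfspaces setIA; do 2 apply: is_polytope_cut. Qed.

Lemma on_set_slabs A i lo s M : 0 <= s -> is_polytope A ->
  v (A `&` slab i lo (lo + M%:R * s)) =
  \sum_(j < M) v (A `&` slab i (lo + j%:R * s) (lo + j.+1%:R * s)).
Proof.
move=> s0 pA; elim: M => [|M IH].
  (* For M = 0 the slab is a hyperplane and not the empty set, so the value is 0 by flatness. *)
  rewrite big_ord0 on_set_flat //; exists (coord_aff i lo); first exact: coord_aff_neq0.
  move=> x [_]; rewrite /slab /= mul0r addr0 coord_affE => x0.
  by apply/eqP; rewrite subr_eq0 eq_le andbC.
rewrite big_ord_recr /= -IH.
have lM : lo <= lo + M%:R * s by rewrite lerDl mulr_ge0.
have Ml : lo + M%:R * s <= lo + M.+1%:R * s by rewrite lerD2l ler_wpM2r // ler_nat.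
rewrite (on_set_cut (is_polytope_slab _ _ _ pA) (coord_aff_neq0 i (lo + M%:R * s))) [RHS]addrC.
congr (v _ + v _); rewrite -setIA; congr (_ `&` _); apply/seteqP; split => x;
  rewrite /slab /halfspace /= ?aff_oppE coord_affE ?oppr_ge0 ?subr_le0 ?subr_ge0.
- by move=> [/andP[_ ->] ->].
- by move=> /andP[x1 ->]; split=> //; rewrite (le_trans lM).
- by move=> [/andP[-> _] ->].
- by move=> /andP[-> x1]; split=> //=; rewrite (le_trans x1).
Qed.

(** Interpolates through boxes with m sides of length 1 / k and the others of length 1; each step
    cuts one long side into k slabs, all translates of the next box. *)
Lemma on_set_cube k : (0 < k)%N -> v (cube d 1) = (k ^ d)%:R *: v (cube d k%:R^-1).
Proof.
move=> k0; pose s : R := k%:R^-1.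
have k0' : 0 < k%:R :> R by rewrite ltr0n.
have s0 : 0 <= s by rewrite invr_ge0 ltW.
pose a m (i : 'I_d) : R := if (i < m)%N then s else 1.
pose box m : set 'rV[R]_d := [set x | forall i, 0 <= x 0 i <= a m i].
have a0 m i : 0 <= a m i by rewrite /a; case: ifP.
have pbox m : is_polytope (box m) by exact: is_polytope_box.
suff H m : (m <= d)%N -> v (cube d 1) = (k ^ m)%:R *: v (box m).
  rewrite (H d) //; congr (_ *: v _); apply/seteqP; split => x /= xi i;
    by have := xi i; rewrite /a ltn_ord.
elim: m => [_|m IH md]; first by rewrite scale1r.
rewrite IH 1?ltnW // expnSr natrM -scalerA; congr (_ *: _).
pose i := Ordinal md.
have am : a m i = 1 by rewrite /a ltnn.
have aS : a m.+1 i = s by rewrite /a ltnSn.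
have aN j : j != i -> a m.+1 j = a m j.
  by move=> ji; rewrite /a ltnS leq_eqVlt -val_eqE /= in ji *; rewrite (negPf ji).
have -> : box m = box m `&` slab i 0 (0 + k%:R * s).
  apply/esym/setIidl => x /(_ i); rewrite am /slab /= add0r mulfV //.
  by rewrite gt_eqF.
rewrite on_set_slabs // scaler_nat -[in RHS](card_ord k) -sumr_const.
apply: eq_bigr => j _; rewrite -[RHS](on_set_translate ((j%:R * s) *: delta_mx 0 i) (pbox m.+1)).
congr v; rewrite !add0r.
have js : 0 <= j%:R * s by rewrite mulr_ge0.
have js1 : j.+1%:R * s <= 1 by rewrite ler_pdivrMr // mul1r ler_nat ltn_ord.
have jS : j.+1%:R * s = j%:R * s + s by rewrite -natr1 mulrDl mul1r.
have dE (y : 'rV[R]_d) c l : (c *: delta_mx 0 i + y) 0 l = (if l == i then c else 0) + y 0 l.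
  by rewrite !mxE eqxx /=; case: eqVneq => _; rewrite ?mulr1 ?mulr0.
apply/seteqP; split => x /=.
  move=> [xb xs]; exists (- (j%:R * s) *: delta_mx 0 i + x); last first.
    by rewrite scaleNr addNKr.
  move=> l; rewrite dE; have [->|li] := eqVneq l i; last by rewrite add0r aN // xb.
  by move: xs; rewrite /slab /= aS jS; lra.
move=> [y yb <-]; split.
  move=> l; rewrite dE; have [->|li] := eqVneq l i; last by rewrite add0r -aN // yb.
  by have := yb i; rewrite aS am; lra.
by rewrite /slab /= dE eqxx; have := yb i; rewrite aS; lra.
Qed.

End OneValuation.

Section Comparison.
Context (phi1 phi2 : polytope R d -> G).
Hypotheses (phi1P : simple_positive phi1) (phi2P : simple_positive phi2).
Hypothesis phi12 : on_set phi1 (cube d 1) = on_set phi2 (cube d 1).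
Local Notation v1 := (on_set phi1).
Local Notation v2 := (on_set phi2).

(** Reduces a comparison on a large box to its grid cells, one coordinate direction at a time; A and
    B vary in the induction because each direction replaces them by their intersections with
    slabs. *)
Lemma on_set_grid (lo s : R) (M : nat) (L : seq 'I_d) A B : 0 <= s -> uniq L ->
  is_polytope A -> is_polytope B ->
  (forall z : 'I_d -> nat,
    let cell := [set x : 'rV[R]_d | forall i, i \in L ->
      lo + (z i)%:R * s <= x 0 i <= lo + (z i).+1%:R * s] in
    C (v2 (B `&` cell) - v1 (A `&` cell))) ->
  let box := [set x : 'rV[R]_d | forall i, i \in L -> lo <= x 0 i <= lo + M%:R * s] in
  C (v2 (B `&` box) - v1 (A `&` box)).
Proof.
move=> s0; elim: L A B => [|i L IH] A B /= uL pA pB H.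
  have := H (fun=> 0%N); congr (C (v2 (_ `&` _) - v1 (_ `&` _)));
    by apply/seteqP; split.
have [iL {}uL] := andP uL.
pose box := [set x : 'rV[R]_d | forall i, i \in L -> lo <= x 0 i <= lo + M%:R * s].
have boxE D : D `&` [set x : 'rV[R]_d | forall j, j \in i :: L ->
    lo <= x 0 j <= lo + M%:R * s] = (D `&` box) `&` slab i lo (lo + M%:R * s).
  apply/seteqP; split => x /=.
    move=> [Dx E]; split; last by apply: E; rewrite inE eqxx.
    by split=> // j jL; apply: E; rewrite inE jL orbT.
  move=> [[Dx E] xi]; split=> // j; rewrite inE => /orP[/eqP -> //|]; exact: E.
have pbox D : is_polytope D -> is_polytope (D `&` box).
  move=> pD; rewrite (_ : D `&` box = foldr (fun i X => X `&` slab i lo (lo + M%:R * s)) D L).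
    by elim: (L) => //= k L' IHL; exact: is_polytope_slab.
  rewrite /box; elim: (L) => [|k L' IHL] /=.
    by rewrite (_ : [set x | _] = setT) ?setIT //; apply/seteqP; split.
  rewrite -IHL -setIA; congr (_ `&` _); apply/seteqP; split => x /=.
    by move=> E; split => [j jL|]; apply: E; rewrite inE ?jL ?orbT ?eqxx.
  by move=> [E xk] j; rewrite inE => /orP[/eqP -> //|]; exact: E.
rewrite !boxE (on_set_slabs phi1P) ?(on_set_slabs phi2P) //; try exact: pbox.
rewrite -sumrB; apply: (cone_sum C_cone) => j _.
rewrite !(setIAC _ box).
apply: IH => //; try exact: is_polytope_slab.
move=> z /=.
(* The j-th slab in direction i and the cell z in the remaining directions form one cell of the full
   list; [uniq] ensures that z keeps its values on L. *)
have := H (fun k => if k == i then nat_of_ord j else z k).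
rewrite -!setIA; congr (C (v2 (_ `&` _) - v1 (_ `&` _))); apply/seteqP; split => x /=.
- move=> E; split; first by have := E i; rewrite inE eqxx; exact.
  move=> k kL; have := E k; rewrite inE kL orbT (_ : (k == i) = false); first exact.
  by apply: contraNF iL => /eqP <-.
- move=> [xi E] k; rewrite inE; have [-> //|ki] := eqVneq k i; exact: E.
- move=> E; split; first by have := E i; rewrite inE eqxx; exact.
  move=> k kL; have := E k; rewrite inE kL orbT (_ : (k == i) = false); first exact.
  by apply: contraNF iL => /eqP <-.
- move=> [xi E] k; rewrite inE; have [-> //|ki] := eqVneq k i; exact: E.
Qed.

Lemma cube_translateE (c : 'rV[R]_d) t : [set c + x | x in cube d t] =
  [set x | forall i, i \in enum 'I_d -> c 0 i <= x 0 i <= c 0 i + t].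
Proof.
apply/seteqP; split => x /=.
  by move=> [y yt <-] i _; have := yt i; rewrite mxE; lra.
move=> E; exists (x - c) => [i|]; last by rewrite addrC subrK.
by have := E i; rewrite !mxE mem_enum => /(_ isT); lra.
Qed.

Lemma is_polytope_cube_translate (c : 'rV[R]_d) t : 0 <= t ->
  is_polytope [set c + x | x in cube d t].
Proof. by move=> t0; exact: (is_polytope_translate c (Polytope (is_polytope_cube d t0))). Qed.

(* The cells of a fine grid that meet [A] lie in [(1 + eps) A]. *)
Lemma on_set_compare A (e eps : R) : is_polytope A -> 0 < e -> 0 < eps ->
  (forall x : 'rV[R]_d, (forall i, `|x 0 i| <= e) -> A x) ->
  C (v2 [set (1 + eps) *: x | x in A] - v1 A).
Proof.
move=> pA e0 eps0 eA.
pose B := [set (1 + eps) *: x | x in A].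
have pB : is_polytope B.
  have := is_polytope_affine (1 + eps) 0 pA; congr is_polytope.
  by apply/seteqP; split => _ [x Ax <-]; exists x; rewrite ?addr0.
have [N N0 AN] := polytope_bounded pA.
(* The side s is the reciprocal of an integer, so that [on_set_cube] makes both valuations agree on
   a cell; s <= eps * e makes a cell meeting A fit into B. *)
pose k := (Num.bound (eps * e)^-1).+1.
have k0 : 0 < k%:R :> R by rewrite ltr0n.
pose s : R := k%:R^-1.
have s0 : 0 < s by rewrite invr_gt0.
have se : s <= eps * e.
  rewrite -[leRHS]invrK lef_pV2 ?posrE ?invr_gt0 ?mulr_gt0 //.
  apply: le_trans (ltW (archi_boundP _)) _; first by rewrite invr_ge0 mulr_ge0 // ltW.
  by rewrite ler_nat.
pose M := (Num.bound (2 * N / s)).+1.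
have MN : 2 * N <= M%:R * s.
  rewrite -ler_pdivrMr //; apply: le_trans (ltW (archi_boundP _)) _.
    by rewrite divr_ge0 ?mulr_ge0 // ltW.
  by rewrite ler_nat.
pose c0 : 'rV[R]_d := const_mx (- N).
have Ms0 : 0 <= M%:R * s by rewrite mulr_ge0 // ltW.
have pbox := is_polytope_cube_translate c0 Ms0.
set box := [set _ | _ in _] in pbox.
have boxE : box = [set x : 'rV[R]_d | forall i, i \in enum 'I_d -> - N <= x 0 i <= - N + M%:R * s].
  by rewrite /box cube_translateE; apply/seteqP; split => x /= E i /E; rewrite mxE.
have Abox : A `&` box = A.
  apply/setIidl => x Ax; rewrite boxE /= => i _; have := AN x Ax i; rewrite ler_norml.
  by move: MN; lra.
suff H : C (v2 (B `&` box) - v1 (A `&` box)).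
  rewrite Abox in H.
  have -> : v2 B - v1 A = (v2 B - v2 (B `&` box)) + (v2 (B `&` box) - v1 A).
    by rewrite addrA subrK.
  apply: (cone_add C_cone) H; apply: (on_set_le phi2P) => //.
  exact: is_polytopeI.
rewrite boxE; apply: on_set_grid => //; [exact: ltW|exact: enum_uniq|].
move=> z cell.
pose cz : 'rV[R]_d := \row_i (- N + (z i)%:R * s).
have cellE : cell = [set cz + x | x in cube d s].
  rewrite cube_translateE; apply/seteqP; split => x /= E i /E; rewrite mxE -natr1 mulrDl mul1r addrA //.
have pcell : is_polytope cell by rewrite cellE; exact/is_polytope_cube_translate/ltW.
have [A0|/eqP/set0P[p [Ap cellp]]] := pselect (A `&` cell = set0).
  by rewrite A0 (on_set0 phi1P) subr0; exact: (on_set_ge0 phi2P).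
have cellB : cell `<=` B.
  move=> x cellx.
  have px i : `|(x - p) 0 i| <= s.
    have := cellp i; have := cellx i; rewrite mem_enum => /(_ isT) + /(_ isT).
    by rewrite !mxE ler_norml -natr1; lra.
  have e1 : 1 + eps != 0 by rewrite gt_eqF // ltr_pwDl // ltW.
  (* From x = p + eps ((x - p) / eps): the second point has sup norm at most s / eps <= e, so it
     lies in A, and x / (1 + eps) is a convex combination of it and p. *)
  exists ((1 + eps)^-1 *: p + (eps / (1 + eps)) *: (eps^-1 *: (x - p))); last first.
    rewrite scalerDr !scalerA mulfV // scale1r.
    have -> : (1 + eps) * (eps / (1 + eps)) / eps = 1.
      by rewrite mulrCA mulfV // mulr1 mulfV // gt_eqF.
    by rewrite scale1r addrC subrK.
  apply: polytope_convex => //.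
  - by rewrite invr_ge0 addr_ge0 // ltW.
  - by rewrite divr_ge0 ?addr_ge0 // ltW.
  - by field.
  - apply: eA => i; rewrite mxE normrM gtr0_norm ?invr_gt0 // mulrC ler_pdivrMr //.
    by rewrite mulrC (le_trans (px i)).
rewrite (setIidr cellB); have -> : v2 cell = v1 cell.
  rewrite cellE (on_set_translate phi1P) ?(on_set_translate phi2P); try exact/is_polytope_cube/ltW.
  have := phi12; rewrite (on_set_cube phi1P (ltn0Sn _ : (0 < k)%N)).
  rewrite (on_set_cube phi2P (ltn0Sn _ : (0 < k)%N)).
  move/scalerI => -> //; by rewrite pnatr_eq0 expn_eq0.
by apply: (on_set_le phi1P) => //; exact: is_polytopeI.
Qed.

End Comparison.
End SimplePositive.

(** * Dimension and prisms *)

Section AffineDim.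
Context {R : realType} {d : nat}.
Implicit Types (A : set 'rV[R]_d) (U : {vspace 'rV[R]_d}).

Lemma dim_rV : \dim {: 'rV[R]_d} = d.
Proof. by rewrite dimvf /dim /= mul1n. Qed.

Definition spanned_by U A := exists x : 'rV[R]_d, forall y, A y -> y - x \in U.

Lemma affine_dim_spanned A : exists2 U, \dim U = affine_dim A & spanned_by U A.
Proof.
rewrite /affine_dim; case: arg_minnP => [|r /asboolP[x [U [Ur AU]]] _].
  by apply/asboolP; exists 0, fullv; split=> [|y _]; [exact: dim_rV|exact: memvf].
by exists U => //; exists x.
Qed.

Lemma affine_dim_le A U : spanned_by U A -> (affine_dim A <= \dim U)%N.
Proof.
move=> [x AU]; have Ud : (\dim U < d.+1)%N by rewrite ltnS -[leqRHS]dim_rV dimvS ?subvf.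
rewrite /affine_dim; case: arg_minnP => [|r _ rmin].
  by apply/asboolP; exists 0, fullv; split=> [|y _]; [exact: dim_rV|exact: memvf].
by apply: (rmin (Ordinal Ud)); apply/asboolP; exists x, U.
Qed.

Lemma affine_dim_le_dim A : (affine_dim A <= d)%N.
Proof. by have [U <- _] := affine_dim_spanned A; rewrite -[leqRHS]dim_rV dimvS ?subvf. Qed.

Lemma spanned_byB U A x y : spanned_by U A -> A x -> A y -> x - y \in U.
Proof.
move=> [z AU] Ax Ay; rewrite (_ : x - y = (x - z) - (y - z)).
  by rewrite memvB ?AU.
by rewrite opprB addrA subrK.
Qed.

Lemma flat_affine_dim A : flat A -> (affine_dim A < d)%N.
Proof.
move=> [h h0 Ah]; pose f := linfun (mulmxr h.1 : 'rV[R]_d -> 'rV[R]_1).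
have [A0|/eqP/set0P[x Ax]] := pselect (A = set0).
  have d0 : (0 < d)%N.
    by rewrite lt0n; apply: contra_neq h0 => d0; move: (h.1); rewrite d0 => l; exact: flatmx0.
  apply: leq_ltn_trans (affine_dim_le (U := 0%VS) _) _; last by rewrite dimv0.
  by exists 0 => y; rewrite A0.
apply: leq_ltn_trans (affine_dim_le (U := lker f) _) _.
  exists x => y Ay; rewrite memv_ker lfunE /= mulmxBl subr_eq0; apply/eqP/matrixP => i j.
  rewrite !ord1; have := Ah y Ay; rewrite -(Ah x Ax) /aff => /addIr; exact.
rewrite -[X in (_ < X)%N]dim_rV -(limg_ker_dim f fullv) capfv -addn1 leq_add2l lt0n dimv_eq0.
apply: contra h0 => /eqP f0; apply/eqP/matrixP => i j.
have : f (delta_mx 0 i) \in limg f by exact/memv_img/memvf.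
by rewrite f0 memv0 lfunE /= -rowE => /eqP/matrixP/(_ 0 j); rewrite !mxE.
Qed.

Lemma affine_dim_flat A : (affine_dim A < d)%N -> flat A.
Proof.
(* A basis of U has fewer than d rows, so some nonzero linear form l vanishes on U and is constant
   on A. *)
have [U <- [x AU]] := affine_dim_spanned A => Ud.
pose B : 'M[R]_(\dim U, d) := \matrix_i (vbasis U)`_i.
have : kermx B^T != 0.
  by rewrite -mxrank_eq0 mxrank_ker mxrank_tr subn_eq0 -ltnNge (leq_ltn_trans (rank_leq_row _)).
case/rowV0Pn => l /sub_kermxP lB l0.
have Bl : B *m l^T = 0 by rewrite -[B]trmxK -trmx_mul lB trmx0.
have Ul y : y \in U -> y *m l^T = 0.
  move=> yU; rewrite (coord_vbasis yU) mulmx_suml big1 // => i _.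
  rewrite -scalemxAl (_ : _ *m _ = row i (B *m l^T)); last by rewrite row_mul rowK.
  by rewrite Bl row0 scaler0.
exists (l^T, - (x *m l^T) 0 0) => /=; first by rewrite -trmx0 (inj_eq trmx_inj).
move=> y /AU/Ul; rewrite mulmxBl /aff /= => /matrixP/(_ 0 0).
by rewrite [LHS]mxE [X in _ + X]mxE => ->; rewrite mxE.
Qed.

Lemma affine_dim_prism A U u : A !=set0 -> spanned_by U A -> \dim U = affine_dim A ->
  u \notin U -> affine_dim (prism_set A u) = (affine_dim A).+1.
Proof.
move=> [p Ap] AU UA uU.
have u0 : u != 0 by apply: contraNneq uU => ->; exact: mem0v.
have dimUu : \dim (U + <[u]>) = (\dim U).+1.
  rewrite dimv_disjoint_sum ?dim_vline ?u0 ?addn1 //.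
  apply/eqP; rewrite -subv0; apply/subvP => z; rewrite memv_cap => /andP[zU /vlineP[k zk]].
  rewrite memv0 zk; have [->|k0] := eqVneq k 0; first by rewrite scale0r.
  by move: zU; rewrite zk rpredZeq (negPf k0) (negPf uU).
apply/eqP; rewrite eqn_leq; apply/andP; split.
  rewrite -UA -dimUu; apply: affine_dim_le; have [x AUx] := AU; exists x.
  move=> _ [y [t [Ay _ ->]]]; rewrite addrAC; apply: memv_add; first exact: AUx.
  by rewrite memvZ // memv_line.
have [V <- PV] := affine_dim_spanned (prism_set A u).
have AP : A `<=` prism_set A u.
  by move=> y Ay; exists y, 0; split; rewrite ?lexx ?ler01 // scale0r addr0.
have uV : u \in V.
  rewrite -(addKr p u) addrC; apply: (spanned_byB PV); last exact: AP.
  by exists p, 1; split; rewrite ?lexx ?ler01 // scale1r.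
(* The intersection of U and V still spans A, so minimality of the dimension of U forces it to be
   U. *)
have UV : (U <= V)%VS.
  have s : spanned_by (U :&: V) A.
    exists p => y Ay; rewrite memv_cap (spanned_byB AU) //.
    by apply: (spanned_byB PV); exact: AP.
  have /affine_dim_le := s; rewrite -UA => le.
  have := geq_leqif (dimv_leqif_sup (capvSl U V)); rewrite le => /esym.
  by rewrite subv_cap subvv.
by rewrite -UA -dimUu dimvS // subv_add UV -memvE.
Qed.

End AffineDim.

(** * Values of a valuation on prisms *)

Section PrismVanishing.
Context {R : realType} {d : nat} {G : vectType R} (C : set G).
Implicit Types (P Q : polytope R d) (U : {vspace 'rV[R]_d}).

Definition prism P u : polytope R d := Polytope (is_polytope_prism u (psetP P)).

Lemma prism_setE (A : set 'rV[R]_d) a w : 0 <= a ->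
  prism_set A (a *: w) = [set z | exists x s, [/\ A x, 0 <= s <= a & z = x + s *: w]].
Proof.
move=> a0; apply/seteqP; split => z /= [x [s [Ax /andP[s0 s1] ->]]].
  exists x, (s * a); split; rewrite ?scalerA // mulr_ge0 //=.
  by rewrite ler_piMl.
have [a0'|an] := eqVneq a 0.
  exists x, 0; split; rewrite ?lexx ?ler01 //.
  have -> : s = 0 by apply/le_anti; rewrite s0 -a0' s1.
  by rewrite !scale0r.
have ap : 0 < a by rewrite lt_neqAle eq_sym an.
exists x, (s / a); split; rewrite ?scalerA ?mulfVK // divr_ge0 //=.
by rewrite ler_pdivrMr // mul1r.
Qed.

Lemma prism0 (A : set 'rV[R]_d) : prism_set A 0 = A.
Proof.
apply/seteqP; split => z; first by move=> [x [t [Ax _ ->]]]; rewrite scaler0 addr0.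
by move=> Az; exists z, 0; split; rewrite ?lexx ?ler01 // scaler0 addr0.
Qed.

Lemma dilate1 P : dilate 1 P = P.
Proof.
apply/pset_inj/seteqP; split => x /=; first by move=> [y Py <-]; rewrite scale1r.
by exists x; rewrite ?scale1r.
Qed.

Lemma dilate_prism n P w :
  pset (dilate n (prism P w)) = pset (prism (dilate n P) (n%:R *: w)).
Proof.
apply/seteqP; split => z /=.
  move=> [_ [x [t [Px t01 ->]]] <-]; exists (n%:R *: x), t; split => //; first by exists x.
  by rewrite scalerDr !scalerA mulrC.
move=> [_ [t [[x Px <-] t01 ->]]]; exists (x + t *: w); first by exists x, t.
by rewrite scalerDr !scalerA mulrC.
Qed.

Context (phi : polytope R d -> G) (phiV : is_valuation phi).

Lemma val_ext P Q : pset P = pset Q -> phi P = phi Q.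
Proof. by move/pset_inj ->. Qed.

(** The taller prism is the one of height m together with a copy of the unit prism moved by m w; the
    two meet in a translate of the base Q. *)
Lemma prism_succ U Q w m : spanned_by U Q -> w \notin U ->
  phi (prism Q (m.+1%:R *: w)) + phi Q = phi (prism Q (m%:R *: w)) + phi (prism Q w).
Proof.
move=> QU wU; have [_ add tr] := phiV.
rewrite -[X in _ + X = _](tr (m%:R *: w)) -[X in _ = _ + X](tr (m%:R *: w)).
have m0 : 0 <= m%:R :> R by [].
have E1 : prism_set Q w = [set z | exists x s, [/\ pset Q x, 0 <= s <= 1 & z = x + s *: w]] by [].
apply: add => /=; rewrite !prism_setE //; apply/seteqP; split => z /=.
- move=> [x [s [Qx /andP[s0 s1] ->]]]; have [sm|/ltW ms] := lerP s m%:R.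
    by left; exists x, s; rewrite s0 sm.
  right; exists (x + (s - m%:R) *: w); last by rewrite addrCA -scalerDl [_%:R + _]addrC subrK.
  exists x, (s - m%:R); split => //; rewrite subr_ge0 ms lerBlDl.
  by rewrite natr1.
- move=> [[x [s [Qx /andP[s0 s1] ->]]]|[_ [x [s [Qx /andP[s0 s1] ->]] <-]]].
    by exists x, s; split => //; rewrite s0 (le_trans s1) // ler_nat.
  exists x, (m%:R + s); split => //; first by rewrite addr_ge0 //= -natr1 lerD2l.
  by rewrite addrCA -scalerDl.
- move=> [x Qx <-]; split; first by exists x, m%:R; rewrite lexx m0 addrC.
  by exists x => //; exists x, 0; rewrite lexx ler01 scale0r addr0.
- move=> [[x [s [Qx /andP[s0 s1] ->]]] [_ [y [t [Qy /andP[t0 t1] ->]]] E]].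
  have E' : x - y = (m%:R + t - s) *: w.
    have -> : x = m%:R *: w + (y + t *: w) - s *: w by rewrite E addrK.
    by rewrite scalerBl scalerDl addrCA addrAC [y + _]addrC addrK.
  (* Transversality: a multiple of w in U has coefficient 0, and with s <= m and 0 <= t this gives s
     = m. *)
  have : (m%:R + t - s) *: w \in U by rewrite -E'; exact: (spanned_byB QU).
  have [c0 _|cn] := eqVneq (m%:R + t - s) 0; last by rewrite rpredZeq (negPf cn) (negPf wU).
  have sm : s = m%:R by apply/le_anti; rewrite s1 /=; lra.
  by exists x; rewrite // sm addrC.
Qed.

(** Used with w a k-th part of a vector and m = k, it gives the value on a thin prism from the full
    one. *)
Lemma prism_mul U Q w m : spanned_by U Q -> w \notin U ->
  phi (prism Q (m%:R *: w)) - phi Q = m%:R *: (phi (prism Q w) - phi Q).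
Proof.
move=> QU wU; elim: m => [|m IH].
  by rewrite [RHS]scale0r; apply/eqP; rewrite subr_eq0; apply/eqP/val_ext; rewrite /= scale0r prism0.
rewrite -[in RHS]natr1 scalerDl scale1r -IH.
have := prism_succ m QU wU => /eqP; rewrite eq_sym -subr_eq => /eqP <-.
by rewrite [RHS]addrA; congr (_ - _); exact: addrAC.
Qed.

End PrismVanishing.

(** * Combinatorial positivity *)

Section HVectors.
Context {R : realType} {d : nat} {G : vectType R} (C : set G).
Hypotheses (C_cone : convex_cone C) (C_pointed : pointed_cone C) (C_closed : vect_closed C).
Implicit Types (P Q : polytope R d) (U : {vspace 'rV[R]_d}).

Definition diff_seq (a : nat -> G) (i : nat) : G := if i is j.+1 then a i - a j else a 0%N.

(* [C(m + 1, r + 1) = C(m, r + 1) + C(m, r)], summed by parts. *)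
Lemma sum_diff_seq (a : nat -> G) n r : a r.+1 = 0 ->
  \sum_(i < r.+2) diff_seq a i *+ 'C(n + r.+1 - i, r.+1) =
  \sum_(i < r.+1) a i *+ 'C(n + r - i, r).
Proof.
move=> ar.
transitivity (\sum_(i < r.+2) a i *+ 'C(n + r.+1 - i, r.+1) -
    \sum_(i < r.+1) a i *+ 'C(n + r - i, r.+1)).
  rewrite big_ord_recl [in RHS]big_ord_recl /= -addrA -sumrB; congr (_ + _).
  by apply: eq_bigr => i _; rewrite /= /bump /= add1n mulrnBl addnS subSS.
rewrite big_ord_recr /= ar mul0rn addr0 -sumrB; apply: eq_bigr => i _.
rewrite -mulrnBr; last by rewrite addnS leq_bin2l // leq_sub2r.
by rewrite addnS subSn ?binS ?addKn // (leq_trans (ltnSE (ltn_ord i))) // leq_addl.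
Qed.

Lemma sum_ord_le (F : nat -> G) r : (r <= d)%N ->
  \sum_(i < d.+1 | (i <= r)%N) F i = \sum_(i < r.+1) F i.
Proof. by move=> rd; rewrite (big_ord_widen d.+1 F). Qed.

Context (phi : polytope R d -> G).
Hypotheses (phiV : is_valuation phi) (phiC : combinatorially_positive C phi).

(** Indexing by naturals, with 0 beyond the dimension, makes the shifted index and the entry at r +
    1 available without ordinal bounds. *)
Lemma hvector_nat P : pset P !=set0 -> exists2 a : nat -> G,
  [/\ (forall n, phi (dilate n P) =
         \sum_(i < (affine_dim P).+1) a i *+ 'C(n + affine_dim P - i, affine_dim P)),
      (forall i, (affine_dim P < i)%N -> a i = 0) &
      is_hvector phi P (fun i : 'I_d.+1 => a i)] &
  forall i, C (a i).
Proof.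
move=> Pn; have [h [h0 hP] hC] := phiC P; have [hs hz] := hP Pn.
have rd := affine_dim_le_dim (pset P).
pose a i := if (i < d.+1)%N then h (inord i) else 0.
have aE (i : 'I_d.+1) : a i = h i by rewrite /a ltn_ord inord_val.
exists a; last first.
  move=> i; rewrite /a; case: ifP => _; last exact: (cone_0 C_cone).
  by have := hC (inord i); rewrite /cone_le subr0.
split.
- move=> n; rewrite hs -(sum_ord_le (fun i => a i *+ 'C(n + affine_dim P - i, affine_dim P))) //.
  apply: eq_bigr => i _.
  by rewrite aE.
- move=> i ri; rewrite /a; case: ifP => // id; apply: hz.
  by rewrite inordK.
- by rewrite (_ : (fun i : 'I_d.+1 => a i) = h) //; apply/funext.
Qed.

Lemma combinatorially_positive_flat P : flat P -> phi P = 0.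
Proof.
move=> /flat_affine_dim rd; set r := affine_dim P in rd.
have [P0|/eqP/set0P Pn] := pselect (pset P = set0); first by have [e0 _ _] := phiV; exact: e0.
have [a [aE az _] aC] := hvector_nat Pn; rewrite -/r in aE az.
have [U Ur PU] := affine_dim_spanned (pset P); rewrite -/r in Ur.
have [u _ uU] : exists2 u, u \in {:'rV[R]_d} & u \notin U.
  apply: contrapT => nu; move: rd; apply/negP; rewrite -leqNgt -Ur -[leqLHS](@dim_rV R) dimvS //.
  apply/subvP => u _; apply: contrapT => /negP uU; by apply: nu; exists u; rewrite ?memvf.
pose Pk (k : nat) := prism P (k%:R^-1 *: u).
have kU k : (0 < k)%N -> k%:R^-1 *: u \notin U.
  by move=> k0; rewrite rpredZeq invr_eq0 pnatr_eq0 (gtn_eqF k0) (negPf uU).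
have dimk k : (0 < k)%N -> affine_dim (Pk k) = r.+1.
  by move=> /kU kU'; apply: affine_dim_prism PU _ kU'.
have Pkn k : pset (Pk k) !=set0.
  by have [x Px] := Pn; exists x; exists x, 0; rewrite lexx ler01 scale0r addr0.
have [b [bE bz _] bC] := hvector_nat (Pkn 1%N).
rewrite dimk // in bE bz.
have dilU n : spanned_by U (dilate n P).
  have [x xU] := PU; exists (n%:R *: x) => _ [y Py <-].
  by rewrite -scalerBr memvZ ?xU.
(* [prism_mul] over the base n P with step n u / k; k such steps make up the dilate of [Pk 1]. *)
have interp k n : (0 < k)%N -> phi (dilate n (Pk k)) =
    (1 - k%:R^-1) *: phi (dilate n P) + k%:R^-1 *: phi (dilate n (Pk 1%N)).
  move=> k0; have kn0 : k%:R != 0 :> R by rewrite pnatr_eq0 -lt0n.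
  rewrite !(val_ext phi (dilate_prism _ _ _)) invr1 scale1r.
  (* For n = 0 the step is the zero vector, which is not transverse, but every prism then collapses
     to [dilate 0 P]. *)
  have [->|n0] := posnP n.
    have E w : pset (prism (dilate 0 P) (0%:R *: w)) = pset (dilate 0 P).
      by rewrite /= scale0r prism0.
    by rewrite !(val_ext phi (E _)) -scalerDl subrK scale1r.
  have wU : n%:R *: (k%:R^-1 *: u) \notin U.
    by rewrite rpredZeq pnatr_eq0 (gtn_eqF n0) (negPf (kU k k0)).
  have := prism_mul phiV k (dilU n) wU.
  rewrite !scalerA mulrCA mulfV // mulr1 => E.
  rewrite scalerBl scale1r -addrA addrC -scalerN -scalerDr [- _ + _]addrC E.
  by rewrite scalerA mulVf // scale1r subrK.
have ar : a r.+1 = 0 by exact: az.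
have diffC i : (i <= r.+1)%N -> C (diff_seq a i).
  move=> ir; apply: (cone_archimedean C_cone C_closed (y := b i)) => k.
  have kn0 : k.+1%:R != 0 :> R by rewrite pnatr_eq0.
  (* By [interp] and uniqueness this is the h-vector of [Pk k.+1], hence in C; k + 1 times it is k
     times the difference plus b, the form that [cone_archimedean] takes. *)
  pose g (j : nat) := (1 - k.+1%:R^-1) *: diff_seq a j + k.+1%:R^-1 *: b j.
  have [c [_ _ ch] cC] := hvector_nat (Pkn k.+1).
  have gh : is_hvector phi (Pk k.+1) (fun j : 'I_d.+1 => g j).
    split => [E|_]; first by have [x] := Pkn k.+1; rewrite E.
    rewrite dimk //; split => [n|j rj].
      rewrite interp // aE bE -(sum_diff_seq n ar).
      rewrite (sum_ord_le (fun i => g i *+ 'C(n + r.+1 - i, r.+1))) //.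
      rewrite !scaler_sumr -big_split; apply: eq_bigr => j _ /=.
      by rewrite mulrnDl !scalerMnr.
    rewrite /g bz // scaler0 addr0; case: (nat_of_ord j) rj => // j' rj /=.
    by rewrite !az ?subrr ?scaler0 // (leq_trans _ rj).
  have id : (i < d.+1)%N by rewrite (leq_ltn_trans ir).
  have gc : g i = c i by have /(congr1 (fun f => f (Ordinal id))) := is_hvector_unique gh ch.
  have := cone_scale C_cone (ler0n R k.+1) (cC i); rewrite -gc /g scalerDr !scalerA.
  by rewrite mulrBr mulr1 mulfV // scale1r -natr1 addrK addrC.
(* Downward induction from a (r + 1) = 0: once a (i + 1) = 0, the difference at i + 1 is - a i, so a
   i and - a i both lie in C. *)
have a0 m : (m <= r.+1)%N -> a (r.+1 - m)%N = 0.
  elim: m => [_|m IH mr]; first by rewrite subn0.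
  have {}IH := IH (ltnW mr).
  apply: C_pointed => //; have := diffC (r.+1 - m)%N (leq_subr _ _).
  have E : (r.+1 - m = (r.+1 - m.+1).+1)%N by rewrite subnSK.
  by rewrite E in IH *; rewrite /diff_seq IH sub0r.
rewrite -(dilate1 P) aE big1 // => i _.
by rewrite -(subKn (ltnW (ltn_ord i))) a0 ?mul0rn // leq_subr.
Qed.

End HVectors.

(** * Multiples of the volume are combinatorially positive *)

Section ScaledVolume.
Context {R : realType} {d : nat} {G : vectType R} (C : set G).
Hypotheses (C_cone : convex_cone C).
Implicit Types (P Q : polytope R d).

Lemma vol_translate t P : vol (translate t P) = vol P.
Proof.
rewrite (@vol_affine _ _ P _ 1 t) ?ltr01 ?expr1n ?mul1r //.
by apply/seteqP; split => _ [x Px <-]; exists x; rewrite // scale1r addrC.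
Qed.

Lemma flat_dilate n P : flat P -> flat (dilate n P).
Proof.
move=> [h h0 Ph]; exists (h.1, n%:R * h.2) => // _ [x Px <-].
have := Ph x Px; rewrite /aff /= -scalemxAl mx11_Z -mulrDr => ->.
by rewrite mulr0.
Qed.

Lemma vol_dilate n P : pset P !=set0 -> vol (dilate n P) = n%:R ^+ d * vol P.
Proof.
move=> [p Pp]; have [n0|n0] := posnP n; last first.
  rewrite (@vol_affine _ _ P _ n%:R 0) ?ltr0n //.
  by apply/seteqP; split => _ [x Px <-]; exists x; rewrite // addr0.
(* The dilate by 0 is a point. In dimension 0 it is P itself, in accordance with 0 ^ 0 = 1; in
   positive dimension it is flat. *)
rewrite n0; have [d0|d0] := posnP d.
  have -> : 0%:R ^+ d = 1 :> R by rewrite d0.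
  rewrite mul1r; congr (vol _); apply/pset_inj/seteqP.
  have all0 (x y : 'rV[R]_d) : x = y.
    by apply/rowP => i; have := ltn_ord i; rewrite [X in (_ < X)%N]d0.
  by split => x /=; [move=> _; rewrite (all0 x p)|exists p => //; exact: all0].
rewrite expr0n (gtn_eqF d0) mul0r; apply: vol_flat.
exists (const_mx 1, 0) => /=; last first.
  by move=> _ [x _ <-]; rewrite /aff scale0r mul0mx mxE addr0.
by apply/eqP => /colP/(_ (Ordinal d0)); rewrite !mxE => /eqP; rewrite oner_eq0.
Qed.

Lemma vol_set0 P : pset P = set0 -> vol P = 0.
Proof. by move=> P0; rewrite /vol P0 lebesgue_vol0. Qed.

Lemma scaled_vol_simple_positive (c : G) : C c -> simple_positive C (scaled_vol c : polytope R d -> G).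
Proof.
move=> Cc; split; first split.
- by move=> P P0; rewrite /scaled_vol vol_set0 // scale0r.
- by move=> P Q U I UE IE; rewrite /scaled_vol -!scalerDl (volUI UE IE).
- by move=> t P; rewrite /scaled_vol vol_translate.
- by move=> P; apply: (cone_scale C_cone) => //; exact: vol_ge0.
- by move=> P fP; rewrite /scaled_vol vol_flat // scale0r.
Qed.

(** The recurrence behind Eulerian numbers: multiplication by n sends a basis element of degree r to
    a nonnegative combination of two of degree r + 1. *)
Lemma mul_bin_shift n r i : (i <= r)%N ->
  (n * 'C(n + r - i, r) = i * 'C(n + r.+1 - i, r.+1) + (r.+1 - i) * 'C(n + r - i, r.+1))%N.
Proof.
move=> ir; rewrite addnS subSn; last by rewrite (leq_trans ir) // leq_addl.
rewrite binS mulnDr addnAC -mulnDl subnKC; last exact: leqW.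
rewrite mul_bin_left -mulnDl.
(* The truncated subtraction is exact in the first case; in the second the binomial coefficient
   vanishes. *)
have [rm|mr] := leqP r (n + r - i); last by rewrite bin_small // !muln0.
by congr (_ * _)%N; lia.
Qed.

(* Worpitzky's identity; [e i] is an Eulerian number. *)
Lemma expn_bin_sum r : exists e : nat -> nat,
  forall n, (n ^ r = \sum_(i < r.+1) e i * 'C(n + r - i, r))%N.
Proof.
elim: r => [|r [e eE]].
  by exists (fun=> 1%N) => n; rewrite big_ord_recl big_ord0 bin0.
(* The guard drops e (r + 1), about which the induction hypothesis says nothing. *)
exists (fun i => (if i < r.+1 then i * e i else 0) + (if i is j.+1 then (r.+1 - j) * e j else 0))%N => n.
rewrite expnS eE big_distrr /=.
transitivity (\sum_(i < r.+1) (i * e i * 'C(n + r.+1 - i, r.+1)) +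
    \sum_(i < r.+1) ((r.+1 - i) * e i * 'C(n + r - i, r.+1)))%N.
  rewrite -big_split; apply: eq_bigr => i _ /=.
  by rewrite mulnCA mul_bin_shift ?mulnDr; [lia|rewrite -ltnS ltn_ord].
under [RHS]eq_bigr do rewrite mulnDl.
rewrite big_split /=; congr (_ + _)%N.
  rewrite [RHS]big_ord_recr /= ltnn mul0n addn0; apply: eq_bigr => i _.
  by rewrite ltn_ord.
rewrite [RHS]big_ord_recl /= mul0n add0n; apply: eq_bigr => i _.
by rewrite /bump /= add1n addnS subSS.
Qed.

Lemma scaled_vol_combinatorially_positive (c : G) : C c ->
  combinatorially_positive C (scaled_vol c : polytope R d -> G).
Proof.
move=> Cc P; have C0 := cone_0 C_cone.
have [[P0|fP]|[Pn rd]] : (pset P = set0 \/ flat P) \/ (pset P !=set0 /\ affine_dim P = d).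
- have [|/eqP/set0P Pn] := pselect (pset P = set0); first by left; left.
  have [|dr] := ltnP (affine_dim P) d; first by left; right; exact: affine_dim_flat.
  right; split=> //; apply/eqP; rewrite eqn_leq dr andbT.
  exact: affine_dim_le_dim.
- exists (fun=> 0); last by move=> i; rewrite /cone_le subr0.
  by split=> // -[x]; rewrite P0.
- exists (fun=> 0); last by move=> i; rewrite /cone_le subr0.
  split=> // _; split=> // n.
  rewrite /scaled_vol vol_flat ?scale0r; last exact: flat_dilate.
  by rewrite big1 // => i _; rewrite mul0rn.
have [e eE] := expn_bin_sum d.
exists (fun i : 'I_d.+1 => (e i)%:R *: scaled_vol c P).
  split=> [P0|_]; first by case: Pn => x; rewrite P0.
  rewrite rd; split=> [n|i]; last by rewrite ltnNge -ltnS ltn_ord.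
  rewrite (sum_ord_le (fun i => ((e i)%:R *: scaled_vol c P) *+ 'C(n + d - i, d))) //.
  rewrite {1}/scaled_vol vol_dilate // -scalerA -natrX eE natr_sum scaler_suml.
  by apply: eq_bigr => i _; rewrite mulnC natrM -scalerA scaler_nat.
move=> i; rewrite /cone_le subr0; apply: (cone_scale C_cone) => //.
by apply: (cone_scale C_cone) => //; exact: vol_ge0.
Qed.

End ScaledVolume.

(** * Squeezing a valuation between multiples of the volume *)

Section Uniqueness.
Context {R : realType} {d : nat} {G : vectType R} (C : set G).
Hypotheses (C_cone : convex_cone C) (C_pointed : pointed_cone C) (C_closed : vect_closed C).

(** Makes the error of a dilation linear in t. A further factor at most triples the coefficient: (1
    + a t)(1 + t) = 1 + a t + t + a t ^ 2 <= 1 + 3 a t when a >= 1 and t <= 1. *)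
Lemma expr_1D_le (t : R) n : 0 <= t <= 1 -> (1 + t) ^+ n <= 1 + 3 ^+ n * t.
Proof.
move=> /andP[t0 t1]; elim: n => [|n IH]; first by rewrite !expr0 mul1r lerDl.
have E1 : 1 <= 3 ^+ n :> R by rewrite exprn_ege1 // ler1n.
rewrite !exprSr; apply: le_trans (ler_wpM2r _ IH) _; first by rewrite addr_ge0.
set a := 3 ^+ n in E1 *.
have at1 : t <= a * t by rewrite ler_peMl.
have at2 : a * t * t <= a * t by rewrite ler_piMr // mulr_ge0 // (le_trans _ E1).
by lra.
Qed.

Lemma expr_1D_inv_ge (t : R) n : 0 <= t <= 1 -> 1 - 3 ^+ n * t <= ((1 + t)^-1) ^+ n.
Proof.
move=> t01; have := expr_1D_le n t01; case/andP: t01 => t0 t1.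
have p0 : 0 < (1 + t) ^+ n by rewrite exprn_gt0 // ltr_pwDl.
rewrite exprVn => H; rewrite -[leRHS]mul1r ler_pdivlMr //.
have K0 : 0 <= 3 ^+ n * t by rewrite mulr_ge0 // exprn_ge0.
set K := 3 ^+ n * t in H K0 *.
have [K1|K1] := lerP (1 - K) 0.
  by rewrite (le_trans _ ler01) // mulr_le0_ge0 // ltW.
by apply: le_trans (ler_wpM2l (ltW K1) H) _; nra.
Qed.

Lemma simple_positive_scaled_vol (phi : polytope R d -> G) : simple_positive C phi ->
  exists2 c, C c & phi = scaled_vol c.
Proof.
move=> phiP; have [phiV phi0 phif] := phiP.
pose Q1 := Polytope (is_polytope_cube d (ler01 : 0 <= 1 :> R)).
exists (phi Q1) => //; set c := phi Q1; have Cc : C c by exact: phi0.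
have psiP := scaled_vol_simple_positive (d := d) C_cone (phi0 Q1); rewrite -/c in psiP.
have E1 : on_set phi (cube d 1) = on_set (scaled_vol c) (cube d 1).
  rewrite -[cube d 1]/(pset Q1) !on_setE /scaled_vol (vol_cube (erefl : pset Q1 = _)).
  by rewrite scale1r.
apply/funext => P0.
have [P00|/eqP/set0P Pn0] := pselect (pset P0 = set0).
  by rewrite /scaled_vol vol_set0 // scale0r; case: phiV => e0 _ _; exact: e0.
have [Pf|[p [e [e0 pe]]]] := flat_or_interior (psetP P0) Pn0.
  by rewrite phif // /scaled_vol vol_flat // scale0r.
(* [on_set_compare] asks for a sup-norm ball around the origin, so the interior point p is moved
   there. *)
have [_ _ tr] := phiV; rewrite -(tr (- p)) /scaled_vol -(vol_translate (- p)).
set P := translate (- p) P0.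
have {pe}Pe (x : 'rV[R]_d) : (forall i, `|x 0 i| <= e) -> pset P x.
  by move=> /pe Px; exists (p + x) => //; rewrite addKr.
have dil a : is_polytope [set a *: x | x in P].
  have := is_polytope_affine a 0 (psetP P); congr is_polytope.
  by apply/seteqP; split => _ [x Px <-]; exists x; rewrite ?addr0.
have vdil a : 0 < a -> vol (Polytope (dil a)) = a ^+ d * vol P.
  move=> a0; apply: (vol_affine (b := 0)) => //.
  by apply/seteqP; split => _ [x Px <-]; exists x; rewrite ?addr0.
pose y := (3 ^+ d * vol P) *: c.
have Cy : C y by apply: (cone_scale C_cone) => //; rewrite mulr_ge0 ?exprn_ge0 ?vol_ge0.
have k01 k : 0 <= (k.+1%:R^-1 : R) <= 1 by rewrite invr_ge0 ler0n invf_le1 ?ltr0n // ler1n.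
(* Replaces the factor a by its limit b at the cost of 3 ^ d / (k + 1); after multiplication by k +
   1 that cost is the fixed vector y, as [cone_archimedean] requires. *)
have main a b (z : G) k : C (z + (a * vol P) *: c) -> a <= b + 3 ^+ d * k.+1%:R^-1 ->
    C (y + k.+1%:R *: (z + (b * vol P) *: c)).
  move=> Cz ab.
  have kn0 : k.+1%:R != 0 :> R by rewrite pnatr_eq0.
  rewrite (_ : y + _ = k.+1%:R *: ((z + (a * vol P) *: c) +
      ((b + 3 ^+ d * k.+1%:R^-1 - a) * vol P) *: c)).
    apply: (cone_scale C_cone) => //; apply: (cone_add C_cone) => //.
    by apply: (cone_scale C_cone) => //; rewrite mulr_ge0 ?vol_ge0 // subr_ge0.
  rewrite -addrA -scalerDl !scalerDr !scalerA /y addrCA -scalerDl; congr (_ + _ *: _).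
  by move: (k.+1%:R : R) kn0 => K kn0; field.
apply/eqP; rewrite -subr_eq0; apply/eqP/C_pointed.
  apply: (cone_archimedean C_cone C_closed (y := y)) => -[|k].
    by rewrite scale0r addr0.
  (* Lower bound: the comparison starts from the shrunken P', so that [phi] is evaluated at P and
     the volume at P'. *)
  pose P' := Polytope (dil (1 + k.+1%:R^-1)^-1).
  have := k01 k; set t := k.+1%:R^-1 => t01; have t0 : 0 < t by rewrite invr_gt0 ltr0n.
  have t1 : 0 < 1 + t by rewrite addr_gt0.
  have P'e (x : 'rV[R]_d) : (forall i, `|x 0 i| <= e / (1 + t)) -> pset P' x.
    move=> xe; exists ((1 + t) *: x); last by rewrite scalerA mulVf ?scale1r // gt_eqF.
    apply: Pe => i; rewrite mxE normrM gtr0_norm // mulrC -ler_pdivlMr //; exact: xe.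
  have := on_set_compare C_cone psiP phiP (esym E1) (psetP P') (divr_gt0 e0 t1) t0 P'e.
  have -> : [set (1 + t) *: x | x in P'] = pset P.
    apply/seteqP; split => x; first by move=> [_ [z Pz <-] <-]; rewrite scalerA mulfV ?scale1r // gt_eqF.
    move=> Px; exists ((1 + t)^-1 *: x); first by exists x.
    by rewrite scalerA mulfV ?scale1r // gt_eqF.
  rewrite !on_setE [scaled_vol c P']/scaled_vol vdil ?invr_gt0 //.
  rewrite -scaleNr -mulNr => H.
  have := main _ (-1) _ k H; rewrite mulN1r scaleNr; apply.
  by rewrite -/t; have := expr_1D_inv_ge d t01; lra.
rewrite opprB; apply: (cone_archimedean C_cone C_closed (y := y)) => -[|k].
  by rewrite scale0r addr0.
have := k01 k; set t := k.+1%:R^-1 => t01; have t0 : 0 < t by rewrite invr_gt0 ltr0n.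
have t1 : 0 < 1 + t by rewrite addr_gt0.
(* Upper bound, with the roles exchanged: [phi] is evaluated at P and the volume at its
   enlargement. *)
have := on_set_compare C_cone phiP psiP E1 (psetP P) e0 t0 Pe.
rewrite -[X in on_set _ X - _]/(pset (Polytope (dil (1 + t)))) !on_setE.
rewrite [scaled_vol c _]/scaled_vol vdil // addrC => H.
have := main _ 1 _ k H; rewrite mul1r [- _ + _]addrC; apply.
by rewrite -/t; exact: expr_1D_le.
Qed.

Lemma combinatorially_positive_ge0 (phi : polytope R d -> G) :
  is_valuation phi -> combinatorially_positive C phi -> forall P, C (phi P).
Proof.
move=> phiV phiC P.
have [P0|/eqP/set0P Pn] := pselect (pset P = set0).
  by case: phiV => e0 _ _; rewrite e0 //; exact: (cone_0 C_cone).
have [a [aE _ _] aC] := hvector_nat C_cone phiC Pn.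
rewrite -(dilate1 P) aE; apply: (cone_sum C_cone) => i _; rewrite -scaler_nat.
exact: (cone_scale C_cone).
Qed.

End Uniqueness.

Theorem theorem6p2 (R : realType) (d : nat) (G : vectType R) (C : set G)
    (C_cone : convex_cone C) (C_pointed : pointed_cone C)
    (C_closed : vect_closed C) :
  [/\ (@cp_valuations R d G C) = [set scaled_vol c | c in C],
      convex_cone (@cp_valuations R d G C) &
      cone_isomorphism C (@cp_valuations R d G C) scaled_vol].
Proof.
have cpE : @cp_valuations R d G C = [set scaled_vol c | c in C].
  apply/seteqP; split => phi.
    move=> [phiV phiC].
    have phiP : simple_positive C phi.
      split=> //; first exact: combinatorially_positive_ge0 phiV phiC.
      exact: combinatorially_positive_flat phiV phiC.
    have [c Cc ->] := simple_positive_scaled_vol C_cone C_pointed C_closed phiP.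
    by exists c.
  move=> [c Cc <-]; split; last exact: scaled_vol_combinatorially_positive.
  by have [] := scaled_vol_simple_positive (d := d) C_cone Cc.
have svD (x y : G) : scaled_vol (x + y) = scaled_vol x + scaled_vol y :> (polytope R d -> G).
  by apply/funext => P; rewrite /scaled_vol scalerDr.
have svZ (a : R) (x : G) : scaled_vol (a *: x) = a *: scaled_vol x :> (polytope R d -> G).
  by apply/funext => P; rewrite /scaled_vol scalerA mulrC -scalerA.
split=> //.
(* The cone axioms are not checked on h-vectors but transported from C along the linear map
   [scaled_vol]. *)
- rewrite cpE; split.
  + exists 0; first exact: (cone_0 C_cone).
    by apply/funext => P; rewrite /scaled_vol scaler0.
  + by move=> _ _ [x Cx <-] [y Cy <-]; exists (x + y); [exact: (cone_add C_cone)|rewrite svD].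
  + by move=> a _ a0 [x Cx <-]; exists (a *: x); [exact: (cone_scale C_cone)|rewrite svZ].
- split=> //; split.
  + by move=> c Cc; rewrite cpE; exists c.
  + move=> x y _ _ /(congr1 (fun f => f (Polytope (is_polytope_cube d (ler01 : 0 <= 1 :> R))))).
    by rewrite /scaled_vol vol_cube // !scale1r.
  + by rewrite cpE => phi.
Qed.
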